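(* Let $n \geq 4$ and let $R(t)$, $t \in [0,T)$, be a solution of the ODE $\frac{d}{dt} R(t) = Q(R(t))$ in the space of algebraic curvature tensors on $\mathbb{R}^n$. If $R(0)$ has nonnegative isotropic curvature, then $R(t)$ has nonnegative isotropic curvature for all $t \in [0,T)$.
   Context: An algebraic curvature tensor on $\mathbb{R}^n$ is a four-linear form $R$ satisfying $R_{ijkl} = -R_{jikl} = -R_{ijlk} = R_{klij}$ and the first Bianchi identity $R_{ijkl}+R_{jkil}+R_{kijl}=0$, with components taken with respect to an orthonormal basis; the sign convention is that $R_{1212}$ is the sectional curvature of the plane spanned by $e_1,e_2$. For such $R$, $Q(R)$ is the algebraic curvature tensor \[Q(R)_{ijkl} = R_{ijpq} \, R_{klpq} + 2 \, R_{ipkq} \, R_{jplq} - 2 \, R_{iplq} \, R_{jpkq},\] with summation over the repeated indices $p,q$ from $1$ to $n$. $R$ has nonnegative isotropic curvature if $R_{1313} + R_{1414} + R_{2323} + R_{2424} - 2 \, R_{1234} \geq 0$ for every orthonormal four-frame $\{e_1,e_2,e_3,e_4\}$ in $\mathbb{R}^n$, where $R_{ijkl} = R(e_i,e_j,e_k,e_l)$. *)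

(* Defs.v *)
From HB Require Import structures.
From mathcomp Require Import all_boot all_order all_algebra.
From mathcomp Require Import all_classical all_reals all_analysis.

Set Implicit Arguments.
Unset Strict Implicit.
Unset Printing Implicit Defensive.

Import Order.TTheory GRing.Theory Num.Theory.
Import numFieldNormedType.Exports.

Local Open Scope classical_set_scope.
Local Open Scope ring_scope.

Section CurvatureTensors.
Context {R : realType} {n : nat}.
Implicit Types (x y z w : 'rV[R]_n).

Definition form4 : Type :=
  'rV[R]_n -> 'rV[R]_n -> 'rV[R]_n -> 'rV[R]_n -> R.

(* The identities on components are required for arbitrary vectors; for a
   four-linear form this is the same as requiring them on a basis. *)
Record algebraic_curvature_tensor (A : form4) : Prop := {
  act_linear1 : forall y z w, scalar (fun x => A x y z w);
  act_linear2 : forall x z w, scalar (fun y => A x y z w);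
  act_linear3 : forall x y w, scalar (fun z => A x y z w);
  act_linear4 : forall x y z, scalar (fun w => A x y z w);
  act_skew12 : forall x y z w, A x y z w = - A y x z w;
  act_skew34 : forall x y z w, A x y z w = - A x y w z;
  act_pair : forall x y z w, A x y z w = A z w x y;
  act_bianchi : forall x y z w, A x y z w + A y z x w + A z x y w = 0
}.

Definition curvQ (A : form4) : form4 := fun x y z w =>
  let e p : 'rV[R]_n := delta_mx 0 p in
  \sum_(p < n) \sum_(q < n)
    (A x y (e p) (e q) * A z w (e p) (e q)
     + 2 * (A x (e p) z (e q) * A y (e p) w (e q))
     - 2 * (A x (e p) w (e q) * A y (e p) z (e q))).

Definition dotv x y : R := \sum_(i < n) x 0 i * y 0 i.

Definition orthonormal_family (s : seq 'rV[R]_n) : Prop :=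
  forall i j, (i < size s)%N -> (j < size s)%N ->
    dotv s`_i s`_j = (i == j)%:R.

Definition nonneg_isotropic_curvature (A : form4) : Prop :=
  forall e1 e2 e3 e4 : 'rV[R]_n,
    orthonormal_family [:: e1; e2; e3; e4] ->
    0 <= A e1 e3 e1 e3 + A e1 e4 e1 e4 + A e2 e3 e2 e3 + A e2 e4 e2 e4
         - 2 * A e1 e2 e3 e4.

(* [t^'] is the punctured neighborhood filter, so at an endpoint of [D] this
   is the one-sided derivative. *)
Definition is_derive_within (D : set R) (f : R -> R) (t l : R) : Prop :=
  (s - t)^-1 * (f s - f t) @[s --> within D t^'] --> l.

(* The half-open interval [0, T), where T = +oo is allowed. *)
Definition time_interval (T : \bar R) : set R :=
  [set t : R | 0 <= t /\ (t%:E < T)%E].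

(* The space of four-linear forms is finite-dimensional, so the derivative of
   a curve in it is taken argumentwise. Values outside [0, T) play no role. *)
Definition curvature_ode_solution (T : \bar R) (A : R -> form4) : Prop :=
  forall t, time_interval T t ->
    algebraic_curvature_tensor (A t) /\
    forall x y z w, is_derive_within (time_interval T)
      (fun s => A s x y z w) t (curvQ (A t) x y z w).

End CurvatureTensors.

Arguments form4 : clear implicits.

(* Main.v *)
Require Import Defs.
From HB Require Import structures.
From mathcomp Require Import all_boot all_order all_algebra.
From mathcomp Require Import all_classical all_reals all_analysis.
From mathcomp Require Import spectral sesquilinear complex ring lra.

(** Nonnegative isotropic curvature is the condition
      R(z, w, zb, wb) >= 0  for all complex z, w with z.z = z.w = w.w = 0,
    where R is extended complex-multilinearly, the dot is the bilinear
    extension of the inner product and xb denotes complex conjugation: for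
    z = e1 + i e2 and w = e3 + i e4 the left-hand side is the
    expression of the definition, by the Bianchi identity, and every
    isotropic plane has such a basis up to scaling. This set of planes
    is invariant under the complex orthogonal group, which is what makes
    Wilking's argument work.

    The heart of the proof is that Q(R)(z, w, zb, wb) >= 0 whenever R is in
    the cone and R(z, w, zb, wb) = 0 ([curvQ_isotropic_ge0]). The first term
    of Q contributes a sum of squares. For the two others, write H for the
    Hermitian form R(., ., conj ., conj .) on bivectors; what remains is

      2 * sum_pq (H(z^p, z^q) H(w^p, w^q) - H(z^p, w^q) H(w^p, z^q)),

    which is the trace of N (J N^T J^T), where N is the Gram matrix of the
    2n bivectors w^e_p and -z^e_p, with e_p the
    standard basis, and J is the standard symplectic matrix.
    Moving the plane (z, w) inside the set of isotropic planes and using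
    that H attains its minimum 0 there shows that N is nonnegative in all
    tangent directions ([tangent_ge0]); these directions form the symplectic
    complement of a three-dimensional space K on which N vanishes, K being
    the set of coefficients (u, v) with u^w + z^v = 0. Since K is itself
    isotropic for the symplectic form, both N and J N^T J^T are supported,
    up to terms that do not contribute to the trace, on the same subspace,
    where both are nonnegative; so the trace is nonnegative
    ([symplectic_trace_ge0]).

    The passage to the ODE is the maximum principle. Perturb R(t) to
    R(t) + eps * exp(K t) * S with S the curvature tensor of the unit sphere,
    whose isotropic curvature is 4. At the first time at which some
    orthonormal four-frame has vanishing perturbed isotropic curvature
    (frames form a compact set, [isotropic_sum_min]) the pointwise statement
    applies to the perturbed tensor, and Q is locally Lipschitz
    ([curvQ_perturb]); so for K large the perturbed isotropic curvature of
    that frame is strictly increasing there, although it was positive before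
    ([perturbed_isotropic_pos]). Then eps tends to 0. *)

Set Implicit Arguments.
Unset Strict Implicit.
Unset Printing Implicit Defensive.

Import Order.TTheory GRing.Theory Num.Theory.
Import numFieldNormedType.Exports.
Local Open Scope ring_scope.

Local Notation conjC := Num.Def.conjC.
Local Notation "M ^cj" := (map_mx conjC M) (at level 30).
Local Notation "x \ox y" := (x^T *m y) (at level 40).
Local Notation "x +i* y" := (Complex x y) (at level 40, left associativity).

(** * Traces of products of Hermitian matrices *)

Section SymplecticTrace.
Local Open Scope sesquilinear_scope.
Variable C : numClosedFieldType.

Lemma adjmxM m n p (A : 'M[C]_(m, n)) (B : 'M[C]_(n, p)) :
  (A *m B)^t* = B^t* *m A^t*.
Proof. by rewrite trmx_mul map_mxM. Qed.

Lemma map_mxCK m n (A : 'M[C]_(m, n)) : (A^cj)^cj = A.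
Proof. by apply/matrixP => i j; rewrite !mxE conjCK. Qed.

Lemma adjmxK m n (A : 'M[C]_(m, n)) : A^t*^t* = A.
Proof. by apply/matrixP => i j; rewrite !mxE conjCK. Qed.

Lemma psd_factor m (M : 'M[C]_m) : M^t* = M ->
  (forall x : 'rV_m, 0 <= (x *m M *m x^t*) 0 0) ->
  exists S : 'M[C]_m, M = S^t* *m S.
Proof.
move=> Mh Mge0.
have Mn : M \is normalmx by apply/normalmxP; rewrite Mh.
have /orthomx_spectralP := Mn; set P := spectralmx M; set d := spectral_diag M.
rewrite invmx_unitary ?spectral_unitarymx // => Me.
have /unitarymxP PP := spectral_unitarymx M; rewrite -/P in PP.
have d_ge0 i : 0 <= d 0 i.
  have e : row i P *m P^t* = delta_mx 0 i by rewrite -row_mul PP row1.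
  have := Mge0 (row i P).
  have -> : row i P *m M *m (row i P)^t* =
      (row i P *m P^t*) *m diag_mx d *m (row i P *m P^t*)^t*.
    by rewrite Me adjmxM adjmxK !mulmxA.
  rewrite e -rowE row_diag_mx -scalemxAl -rowE !mxE.
  by rewrite !eqxx conjC1 !mulr1.
exists (diag_mx (map_mx sqrtC d) *m P).
rewrite adjmxM Me -!mulmxA; congr (_ *m _).
rewrite mulmxA tr_diag_mx map_diag_mx mulmx_diag; congr (diag_mx _ *m _).
apply/rowP => j; rewrite !mxE.
by rewrite /= geC0_conj ?sqrtC_ge0 // -expr2 sqrtCK.
Qed.

(** Writing M = S^* S turns the trace into a sum of values of the form of M'
    at the rows of S. *)
Lemma mxtrace_psdM m (M M' : 'M[C]_m) : M^t* = M ->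
  (forall x : 'rV_m, 0 <= (x *m M *m x^t*) 0 0) ->
  (forall x : 'rV_m, 0 <= (x *m M' *m x^t*) 0 0) -> 0 <= \tr (M *m M').
Proof.
move=> Mh Mge0 M'ge0; have [S ->] := psd_factor Mh Mge0.
rewrite -mulmxA mxtrace_mulC; apply: sumr_ge0 => i _.
suff -> : (S *m M' *m S^t*) i i = (row i S *m M' *m (row i S)^t*) 0 0 by [].
by rewrite -row_mul !mxE; apply: eq_bigr => j _; rewrite !mxE.
Qed.

(** N is only assumed nonnegative on the symplectic complement V of K, and V
    contains K because K is isotropic. Let P1 and P2 be the orthogonal
    projections onto K and onto its image under J and conjugation, which is
    the orthogonal complement of V. Then P1 kills N, P2 kills
    N' = J N^T J^T, and P = 1 - P1 - P2 projects onto the orthogonal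
    complement of K in V, so the trace of N N' equals that of (PNP)(PN'P).
    As J intertwines P with its conjugate, PN'P is nonnegative because PNP
    is. *)
Lemma symplectic_trace_ge0 m k (N J : 'M[C]_m) (K : 'M[C]_(k, m)) :
  N^t* = N -> J^cj = J -> J^T = - J -> J *m J^T = 1%:M ->
  K *m N = 0 -> K *m J *m K^T = 0 -> K *m K^t* = 1%:M ->
  (forall x : 'rV_m, K *m J *m x^T = 0 -> 0 <= (x *m N *m x^t*) 0 0) ->
  0 <= \tr (N *m (J *m N^T *m J^T)).
Proof.
move=> Nh Jr Jskew JJ KN KJK KK Nge0.
have JtJ : J^T *m J = 1%:M by rewrite mulmx1C.
have J2 : J *m J = - 1%:M by rewrite -[X in X *m _]opprK -Jskew mulNmx JtJ.
pose P1 := K^t* *m K; pose P2 := J *m P1^T *m J^T.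
pose N' := J *m N^T *m J^T.
have P1h : P1^t* = P1 by rewrite /P1 adjmxM adjmxK.
have NK : N *m K^t* = 0 by rewrite -Nh -adjmxM KN trmx0 map_mx0.
have NP : N *m P1 = 0 by rewrite /P1 mulmxA NK mul0mx.
have PN : P1 *m N = 0 by rewrite /P1 -mulmxA KN mulmx0.
have NP' : N' *m P2 = 0.
  rewrite /N' /P2 !mulmxA -[_ *m J^T *m J]mulmxA JtJ mulmx1.
  by rewrite -[_ *m N^T *m _]mulmxA -trmx_mul PN trmx0 mulmx0 mul0mx.
have PN' : P2 *m N' = 0.
  rewrite /N' /P2 !mulmxA -[_ *m J^T *m J]mulmxA JtJ mulmx1.
  by rewrite -[_ *m P1^T *m _]mulmxA -trmx_mul NP trmx0 mulmx0 mul0mx.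
have P1c : P1^cj = P1^T by rewrite -[in RHS]P1h map_trmx trmxK.
have JtC : J^T^cj = J^T by rewrite -map_trmx Jr.
have P2h : P2^t* = P2.
  by rewrite /P2 !adjmxM !trmxK !Jr P1c JtC mulmxA.
have PP0 : P1 *m P2 = 0.
  rewrite /P2 {1}/P1 {1}/P1 [(_ *m K)^T]trmx_mul !mulmxA.
  by rewrite -[_ *m K *m J]mulmxA -[_ *m (K *m J) *m _]mulmxA KJK mulmx0 !mul0mx.
have PP0' : P2 *m P1 = 0.
  by rewrite -P1h -P2h -adjmxM PP0 trmx0 map_mx0.
pose P := 1%:M - P1 - P2.
have Ph : P^t* = P.
  by rewrite /P !linearB /= !map_mxB trmx1 map_mx1 P1h P2h.
have P1i : P1 *m P1 = P1.
  by rewrite /P1 mulmxA -[_ *m K *m _]mulmxA KK mulmx1.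
have P2i : P2 *m P2 = P2.
  rewrite /P2 !mulmxA -[_ *m J^T *m J]mulmxA JtJ mulmx1.
  by rewrite -[_ *m P1^T *m P1^T]mulmxA -trmx_mul P1i.
have Pi : P *m P = P.
  rewrite /P !mulmxBr !mulmxBl !mulmx1 !mul1mx P1i P2i PP0 PP0'.
  by rewrite !subrr !subr0 !addrN !subr0.
(* The conjugate of P1 is P1^T, so conjugation by J exchanges P1 and P2. *)
have PJ : J *m (P^cj) = P *m J.
  rewrite /P !map_mxB map_mx1 P1c /P2 !map_mxM JtC P1h Jr.
  rewrite !mulmxBr !mulmxBl mulmx1 mul1mx !mulmxA J2.
  rewrite -[_ *m J^T *m J]mulmxA JtJ mulmx1 mulNmx mul1mx mulNmx Jskew.
  by rewrite mulmxN opprK mulNmx addrAC.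
have KJP : K *m J *m P^T = 0.
  rewrite /P /P2 !linearB /= trmx1 !trmx_mul !trmxK mulmx1 !mulmxA.
  rewrite KJK !mul0mx subr0 -[K *m J *m J]mulmxA J2 mulmxN mulmx1.
  by rewrite !mulNmx KK mul1mx Jskew mulmxN opprK subrr.
(* [KJP] says that every vector of the form x P lies in V. *)
have PNPge0 (x : 'rV_m) : 0 <= ((x *m P) *m N *m (x *m P)^t*) 0 0.
  by apply: Nge0; rewrite trmx_mul mulmxA KJP mul0mx.
have N'E (x : 'rV_m) : 0 <= ((x *m P) *m N' *m (x *m P)^t*) 0 0.
  have := PNPge0 ((x^cj) *m J).
  have -> : x^cj *m J *m P = (x *m P)^cj *m J.
    rewrite -mulmxA -[J *m P]map_mxCK [(J *m P)^cj]map_mxM Jr PJ.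
    by rewrite !map_mxM Jr mulmxA.
  move: (x *m P) => z; rewrite /N'.
  suff -> : z^cj *m J *m N *m (z^cj *m J)^t* =
    (z *m (J *m N^T *m J^T) *m z^t*)^T by rewrite mxE.
  rewrite !trmx_mul !map_mxM JtC !trmxK !mulmxA.
  by rewrite -map_trmx map_mxCK map_trmx trmxK.
have -> : \tr (N *m (J *m N^T *m J^T)) = \tr ((P *m N *m P) *m (P *m N' *m P)).
  have NPN : N *m P *m N' = N *m N'.
    by rewrite /P !mulmxBr mulmx1 NP subr0 mulmxBl -mulmxA PN' mulmx0 subr0.
  have PNN : \tr (P *m (N *m N')) = \tr (N *m N').
    rewrite mxtrace_mulC /P !mulmxBr mulmx1 -[N *m N' *m P2]mulmxA NP' mulmx0 subr0.
    rewrite linearB /= [\tr (_ *m P1)]mxtrace_mulC [P1 *m _]mulmxA PN mul0mx.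
    by rewrite linear0 subr0.
  rewrite -/N' -PNN -NPN !mulmxA -[P *m N *m P *m P]mulmxA Pi.
  by rewrite [RHS]mxtrace_mulC !mulmxA Pi.
apply: mxtrace_psdM => [|x|x].
- by rewrite !adjmxM Ph Nh mulmxA.
- by have := PNPge0 x; rewrite adjmxM Ph !mulmxA.
- by have := N'E x; rewrite adjmxM Ph !mulmxA.
Qed.

End SymplecticTrace.

Definition symp (F : comNzRingType) n : 'M[F]_(n + n) := block_mx 0 1%:M (- 1%:M) 0.

Lemma symp_conj_block (F : comNzRingType) n (a b c d : 'M[F]_n) :
  symp F n *m (block_mx b (- d) (- c) a)^T *m (symp F n)^T = block_mx a^T d^T c^T b^T.
Proof.
rewrite /symp !tr_block_mx !mulmx_block !(linearN trmx) /= trmx1 trmx0.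
by rewrite !(mul0mx, mulmx0, mul1mx, mulmx1, mulNmx, mulmxN, add0r, addr0, opprK).
Qed.

Lemma mxtrace_mul_tr (F : comNzRingType) n (a b : 'M[F]_n) :
  \tr (a *m b^T) = \sum_p \sum_q a p q * b p q.
Proof.
by apply: eq_bigr => p _; rewrite mxE; apply: eq_bigr => q _; rewrite mxE.
Qed.

Lemma mxtrace_symp_block (F : comNzRingType) n (a b c d : 'M[F]_n) :
  let N := block_mx b (- d) (- c) a in
  \tr (N *m (symp F n *m N^T *m (symp F n)^T)) =
  2 * \sum_p \sum_q (a p q * b p q - c p q * d p q).
Proof.
rewrite /= symp_conj_block mulmx_block mxtrace_block !mulNmx !mxtraceD.
rewrite !(linearN mxtrace) /= !mxtrace_mul_tr -!sumrN -!big_split mulr_sumr.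
apply: eq_bigr => p _; rewrite -!sumrN -!big_split mulr_sumr.
by apply: eq_bigr => q _ /=; ring.
Qed.

(** * Bilinear products and Hermitian forms *)

(** The bilinear dot product; over the complex numbers no conjugation is
    involved, so that isotropic vectors exist. *)
Definition dotr (F : comNzRingType) n (x y : 'rV[F]_n) : F :=
  \sum_(i < n) x 0 i * y 0 i.

Section Dot.
Variables (F : comNzRingType) (n : nat).
Implicit Types x y z : 'rV[F]_n.

Lemma dotrC x y : dotr x y = dotr y x.
Proof. by apply: eq_bigr => i _; rewrite mulrC. Qed.

Lemma dotrDl x y z : dotr (x + y) z = dotr x z + dotr y z.
Proof. by rewrite -big_split; apply: eq_bigr => i _; rewrite mxE mulrDl. Qed.

Lemma dotrZl c x z : dotr (c *: x) z = c * dotr x z.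
Proof. by rewrite mulr_sumr; apply: eq_bigr => i _; rewrite mxE mulrA. Qed.

Lemma dotrNl x z : dotr (- x) z = - dotr x z.
Proof. by rewrite -scaleN1r dotrZl mulN1r. Qed.

Lemma dotrDr x y z : dotr z (x + y) = dotr z x + dotr z y.
Proof. by rewrite dotrC dotrDl !(dotrC z). Qed.

Lemma dotrZr c x z : dotr z (c *: x) = c * dotr z x.
Proof. by rewrite dotrC dotrZl (dotrC z). Qed.

Lemma dotrNr x z : dotr z (- x) = - dotr z x.
Proof. by rewrite dotrC dotrNl dotrC. Qed.

Lemma dotr0l x : dotr 0 x = 0.
Proof. by rewrite -(scale0r 0) dotrZl mul0r. Qed.

Lemma dotr0r x : dotr x 0 = 0.
Proof. by rewrite dotrC dotr0l. Qed.

Lemma mulmx_rows k (f g : 'I_k -> 'rV[F]_n) i j :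
  ((\matrix_i f i) *m (\matrix_i g i)^T) i j = dotr (f i) (g j).
Proof. by rewrite mxE; apply: eq_bigr => l _; rewrite !mxE. Qed.

Lemma mulmx_rows_tr k (f : 'I_k -> 'rV[F]_n) x i :
  ((\matrix_i f i) *m x^T) i 0 = dotr (f i) x.
Proof. by rewrite mxE; apply: eq_bigr => l _; rewrite !mxE. Qed.

Definition dotrE := (dotr0l, dotr0r, dotrDl, dotrDr, dotrNl, dotrNr, dotrZl, dotrZr).
End Dot.

Lemma dotr_conj (C : numClosedFieldType) n (x y : 'rV[C]_n) :
  (dotr x y)^* = dotr (x^cj) (y^cj).
Proof. by rewrite rmorph_sum; apply: eq_bigr => i _; rewrite rmorphM !mxE. Qed.

Section HermitianForm.
Variables (C : numClosedFieldType) (V : lmodType C) (H : V -> V -> C).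
Hypothesis Hlin : forall y, scalar (H^~ y).
Hypothesis Hherm : forall x y, H y x = (H x y)^*.

Lemma formDl x y z : H (x + y) z = H x z + H y z.
Proof. by have := Hlin z 1 x y; rewrite scale1r mul1r. Qed.
Lemma form0l z : H 0 z = 0.
Proof. by apply: (addIr (H 0 z)); rewrite -formDl !add0r. Qed.
Lemma formZl c x z : H (c *: x) z = c * H x z.
Proof. by have := Hlin z c x 0; rewrite !addr0 form0l addr0. Qed.
Lemma formNl x z : H (- x) z = - H x z.
Proof. by rewrite -scaleN1r formZl mulN1r. Qed.
Lemma formDr x y z : H z (x + y) = H z x + H z y.
Proof. by rewrite Hherm formDl rmorphD /= -!Hherm. Qed.
Lemma formZr c x z : H z (c *: x) = c^* * H z x.
Proof. by rewrite Hherm formZl rmorphM /= -Hherm. Qed.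
Lemma form0r z : H z 0 = 0.
Proof. by rewrite Hherm form0l rmorph0. Qed.
Lemma formNr x z : H z (- x) = - H z x.
Proof. by rewrite -scaleN1r formZr rmorphN rmorph1 mulN1r. Qed.
Lemma form_suml I (r : seq I) P (F : I -> V) z :
  H (\sum_(i <- r | P i) F i) z = \sum_(i <- r | P i) H (F i) z.
Proof. by elim/big_rec2: _ => [|i y1 y2 _ <-]; rewrite ?form0l ?formDl. Qed.
Lemma form_sumr I (r : seq I) P (F : I -> V) z :
  H z (\sum_(i <- r | P i) F i) = \sum_(i <- r | P i) H z (F i).
Proof. by elim/big_rec2: _ => [|i y1 y2 _ <-]; rewrite ?form0r ?formDr. Qed.

Lemma ge0_of_small_perturbation (c B : C) : c \is Num.real -> 0 <= B ->
  (forall t, 0 < t <= 1 -> 0 <= c + t * B) -> 0 <= c.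
Proof.
move=> cR B0 h; rewrite real_leNgt ?real0 //; apply/negP => c0.
have d0 : 0 < - c + B + 1 by rewrite ltr_wpDl ?ltr01 // addr_ge0 // oppr_ge0 ltW.
have := h (- c / (- c + B + 1)).
rewrite divr_gt0 ?oppr_gt0 // ler_pdivrMr // mul1r -addrA lerDl.
rewrite addr_ge0 ?ler01 // => /(_ isT).
have -> : c + - c / (- c + (B + 1)) * B = c * (1 - c) / (- c + B + 1).
  by rewrite addrA; field; rewrite gt_eqF.
rewrite lt_geF // pmulr_llt0 ?invr_gt0 // nmulr_rlt0 //.
by rewrite subr_gt0 (lt_trans c0) ?ltr01.
Qed.

Definition roots4 : seq C := [:: 1; 'i; - 1; - 'i].

(** Averaging the form over the four directions s, i s, -s, -i s removes from
    its expansion every term in s^j (conj s)^k except those with j = k mod 4.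
    The constant term vanishes by assumption, so the dominant remaining term
    is |s|^2 H(v1, v1). *)
Lemma second_variation m (v : nat -> V) : (1 < m)%N ->
  (forall s, 0 <= H (\sum_(j < m) s ^+ j *: v j) (\sum_(j < m) s ^+ j *: v j)) ->
  H (v 0%N) (v 0%N) = 0 -> 0 <= H (v 1%N) (v 1%N).
Proof.
move=> m1 Hge0 H00.
pose kap j k : C := \sum_(w <- roots4) w ^+ j * w^* ^+ k.
pose c (p : 'I_m * 'I_m) := kap p.1 p.2 * H (v p.1) (v p.2).
pose i1 := Ordinal m1.
have kap11 : kap 1%N 1%N = 4.
  rewrite /kap /roots4 !big_cons big_nil !expr1 !rmorphN !rmorph1 /= !conjCi.
  rewrite !mulrN !mulNr !mulr1 -expr2 sqrCi !opprK; ring.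
have kap0 j k : (j + k <= 2)%N -> (j, k) <> (1, 1)%N -> kap j k * H (v j) (v k) = 0.
  rewrite /kap /roots4 !big_cons big_nil !rmorphN !rmorph1 /= !conjCi.
  have i2 := sqrCi C.
  case: j k => [|[|[|j]]] [|[|[|k]]] //= _ _;
    rewrite ?H00 ?mulr0 ?expr0 ?expr1 ?sqrrN ?i2 ?expr1n; ring.
have avg (t : C) : 0 <= t -> 0 <= \sum_(p : 'I_m * 'I_m) t ^+ (p.1 + p.2) * c p.
  move=> t0.
  have -> : \sum_(p : 'I_m * 'I_m) t ^+ (p.1 + p.2) * c p = \sum_(w <- roots4)
    H (\sum_(j < m) (w * t) ^+ j *: v j) (\sum_(j < m) (w * t) ^+ j *: v j).
    under [RHS]eq_bigr => w _.
      rewrite form_suml; under eq_bigr => j _.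
        rewrite form_sumr; under eq_bigr => k _.
          rewrite formZl formZr.
          over.
        over.
      rewrite pair_big /=. over.
    rewrite exchange_big /=; apply: eq_bigr => -[j k] _ /=.
    rewrite /c /kap /= mulr_suml mulr_sumr; apply: eq_bigr => w _.
    by rewrite rmorphXn rmorphM /= (geC0_conj t0) !exprMn exprD; ring.
  by apply: sumr_ge0 => w _; exact: Hge0.
pose B := \sum_(p | p != (i1, i1)) `|c p|.
have cE : c (i1, i1) = 4 * H (v 1%N) (v 1%N) by rewrite /c /= kap11.
have cR : c (i1, i1) \is Num.real by rewrite cE rpredM ?realn // CrealE -Hherm.
suff : 0 <= c (i1, i1) by rewrite cE pmulr_rge0 // ltr0n.
apply: (@ge0_of_small_perturbation _ B) => //; first by apply: sumr_ge0.
move=> t /andP[t0 t1].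
have := avg t (ltW t0); rewrite (bigD1 (i1, i1)) //=.
pose S := \sum_(p | p != (i1, i1)) t ^+ (p.1 + p.2 - 3) * c p.
have -> : \sum_(p | p != (i1, i1)) t ^+ (p.1 + p.2) * c p = t ^+ 3 * S.
  rewrite mulr_sumr; apply: eq_bigr => -[j k] /= njk.
  have [le2|lt2] := leqP (j + k) 2.
    suff -> : c (j, k) = 0 by rewrite !mulr0.
    apply: kap0 => //= -[j1 k1]; case/eqP: njk; congr pair; exact: val_inj.
  by rewrite mulrA -exprD subnKC.
have -> : t ^+ (1 + 1) * c (i1, i1) + t ^+ 3 * S = t ^+ 2 * (c (i1, i1) + t * S) by ring.
rewrite pmulr_rge0 ?exprn_gt0 // => cS.
have SB : `|t * S| <= t * B.
  rewrite normrM gtr0_norm // ler_pM2l //; apply: le_trans (ler_norm_sum _ _ _) _.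
  apply: ler_sum => p _; rewrite normrM ger0_norm ?exprn_ge0 //; last exact: ltW.
  by rewrite ler_piMl // exprn_ile1 // ltW.
have tSR : t * S \is Num.real.
  by rewrite -(addrK (c (i1, i1)) (t * S)) rpredB // addrC ger0_real.
apply: le_trans cS _; rewrite lerD2l; apply: le_trans SB.
exact: real_ler_norm.
Qed.

End HermitianForm.

(** * The second variation at an isotropic plane *)

Section IsotropicPlane.
Local Open Scope sesquilinear_scope.
Variables (C : numClosedFieldType) (n : nat) (H : 'M[C]_n -> 'M[C]_n -> C).
Hypothesis Hlin : forall M', scalar (H^~ M').
Hypothesis Hherm : forall M M', H M' M = (H M M')^*.
Hypothesis Hskew : forall M M', H M^T M' = - H M M'.
Hypothesis Hiso : forall x y : 'rV[C]_n,
  dotr x x = 0 -> dotr x y = 0 -> dotr y y = 0 -> 0 <= H (x \ox y) (x \ox y).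

Local Definition Hl := (formDl Hlin, formZl Hlin, formNl Hlin, form0l Hlin).
Local Definition Hr := (formDr Hlin Hherm, formZr Hlin Hherm,
  formNr Hlin Hherm, form0r Hlin Hherm).

Lemma form_sym0 M M' : M^T = M -> H M M' = 0.
Proof.
by move=> Ms; apply/eqP; rewrite -[_ == 0](mulrn_eq0 _ 2) mulr2n -{1}Ms Hskew addNr.
Qed.

(** By skewness H only sees the bivector of a matrix, and a symmetric matrix
    has none. *)
Lemma form_modsym M S : S^T = S -> H (M + S) (M + S) = H M M.
Proof.
move=> Ss; rewrite !Hl (form_sym0 _ Ss) addr0 Hherm !Hl (form_sym0 _ Ss) addr0.
by rewrite -Hherm.
Qed.

Lemma tr_tens (x y : 'rV[C]_n) : (x \ox y)^T = y \ox x.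
Proof. by rewrite trmx_mul trmxK. Qed.

Variables z e : 'rV[C]_n.
Hypotheses (zz : dotr z z = 0) (ee : dotr e e = 0) (ze : dotr z e = 0).
Hypotheses (zzb : dotr z (z^cj) = 2) (eeb : dotr e (e^cj) = 2).
Hypothesis zeb : dotr z (e^cj) = 0.
Hypothesis H0 : H (z \ox e) (z \ox e) = 0.

Let ez : dotr e z = 0. Proof. by rewrite dotrC. Qed.
Let ezb : dotr e (z^cj) = 0.
Proof.
have := congr1 conjC zeb; rewrite dotr_conj rmorph0 dotrC => <-; congr dotr.
by rewrite map_mxCK.
Qed.
Let zbz : dotr (z^cj) z = 2. Proof. by rewrite dotrC. Qed.
Let ebe : dotr (e^cj) e = 2. Proof. by rewrite dotrC. Qed.
Let ebz : dotr (e^cj) z = 0. Proof. by rewrite dotrC. Qed.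
Let zbe : dotr (z^cj) e = 0. Proof. by rewrite dotrC. Qed.
Let zbzb : dotr (z^cj) (z^cj) = 0. Proof. by rewrite -dotr_conj zz rmorph0. Qed.
Let ebeb : dotr (e^cj) (e^cj) = 0. Proof. by rewrite -dotr_conj ee rmorph0. Qed.
Let zbeb : dotr (z^cj) (e^cj) = 0. Proof. by rewrite -dotr_conj ze rmorph0. Qed.
Let ebzb : dotr (e^cj) (z^cj) = 0. Proof. by rewrite -dotr_conj ez rmorph0. Qed.

(** The conditions on (u, w) are the linearized isotropy conditions at (z, e).
    After removing the components of u and w in the plane, (u, w) is the
    velocity of an explicit quadratic curve of isotropic planes; the removed
    components only scale the bivector of z and e, by a factor 1 + l s, up to
    symmetric matrices. As H vanishes at (z, e) and is nonnegative along the
    curve, its second variation is nonnegative. *)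
Lemma tangent_ge0 (u w : 'rV[C]_n) :
  dotr u z = 0 -> dotr w e = 0 -> dotr u e + dotr z w = 0 ->
  0 <= H (u \ox e + z \ox w) (u \ox e + z \ox w).
Proof.
move=> uz we uew.
pose u1 := u - (dotr u (z^cj) / 2) *: z - (dotr u (e^cj) / 2) *: e.
pose w1 := w - (dotr w (z^cj) / 2) *: z - (dotr w (e^cj) / 2) *: e.
pose l := dotr u (z^cj) / 2 + dotr w (e^cj) / 2.
have u1z : dotr u1 z = 0 by rewrite /u1 !dotrE uz zz ez; ring.
have w1e : dotr w1 e = 0 by rewrite /w1 !dotrE we ze ee; ring.
have u1ew : dotr u1 e + dotr z w1 = 0.
  by rewrite -[RHS]uew /u1 /w1 !dotrE ze ee zz; ring.
have u1zb : dotr u1 (z^cj) = 0 by rewrite /u1 !dotrE zzb ezb; field.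
have u1eb : dotr u1 (e^cj) = 0 by rewrite /u1 !dotrE zeb eeb; field.
have w1zb : dotr w1 (z^cj) = 0 by rewrite /w1 !dotrE zzb ezb; field.
have w1eb : dotr w1 (e^cj) = 0 by rewrite /w1 !dotrE zeb eeb; field.
(* The second-order terms al and be cancel u1.u1, u1.w1 and w1.w1 against
   the pairings z.zb = e.eb = 2; the plane of zb and eb is isotropic and
   orthogonal to u1 and w1, so no terms of higher order arise. *)
pose a1 := dotr u1 u1 / 4; pose a2 := dotr u1 w1 / 4; pose a3 := dotr w1 w1 / 4.
pose al := - a1 *: z^cj - a2 *: e^cj.
pose be := - a2 *: z^cj - a3 *: e^cj.
pose X s := (1 + l * s) *: (z + s *: u1 + s ^+ 2 *: al).
pose Y s := e + s *: w1 + s ^+ 2 *: be.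
pose v1 := u1 \ox e + z \ox w1.
pose v2 := al \ox e + u1 \ox w1 + z \ox be.
pose v3 := al \ox w1 + u1 \ox be.
pose v := nth 0 [:: z \ox e; v1 + l *: (z \ox e); v2 + l *: v1; v3 + l *: v2;
  al \ox be + l *: v3; l *: (al \ox be)].
have XY s : \sum_(j < 6) s ^+ j *: v j = X s \ox Y s.
  rewrite !big_ord_recl big_ord0 /= /X /Y /v3 /v2 /v1.
  by apply/matrixP => i j; rewrite !mxE !big_ord1 !mxE; ring.
have -> : u \ox e + z \ox w = v 1%N +
    ((dotr u (e^cj) / 2) *: (e \ox e) + (dotr w (z^cj) / 2) *: (z \ox z)).
  rewrite /v /= /v1 /u1 /w1 /l.
  by apply/matrixP => i j; rewrite !mxE !big_ord1 !mxE; ring.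
rewrite form_modsym; last by rewrite linearD !linearZ /= !tr_tens.
apply: (@second_variation _ _ _ Hlin Hherm 6) => // s; rewrite XY.
have zw1 : dotr z w1 = - dotr e u1.
  by rewrite (dotrC e); apply/eqP; rewrite -addr_eq0 addrC u1ew.
have sym := (dotrC z u1, dotrC e w1, dotrC (z^cj) u1, dotrC (e^cj) u1,
             dotrC (z^cj) w1, dotrC (e^cj) w1).
have dE := (u1z, w1e, u1zb, u1eb, w1zb, w1eb, zz, ee, ze, zzb, eeb, zeb, ez, ezb,
  zbz, ebe, ebz, zbe, zbzb, ebeb, zbeb, ebzb).
clearbody u1 w1 l.
apply: Hiso; rewrite /X /Y /al /be !dotrE !sym !dE.
- by rewrite /a1; field.
- by rewrite zw1 (dotrC e u1) /a2; field.
- by rewrite /a3; field.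
Qed.

Local Notation d := (@delta_mx C 1 n 0).

Let N : 'M[C]_(n + n) :=
  block_mx (\matrix_(p, q) H (e \ox d p) (e \ox d q))
           (- \matrix_(p, q) H (e \ox d p) (z \ox d q))
           (- \matrix_(p, q) H (z \ox d p) (e \ox d q))
           (\matrix_(p, q) H (z \ox d p) (z \ox d q)).

(* The sign makes the combination of the G with coefficients (u, w) equal, up
   to symmetric matrices, to - (u (x) e + z (x) w): for suitable (u, w) this
   is a tangent vector as in [tangent_ge0]. *)
Let G (P : 'I_(n + n)) : 'M[C]_n :=
  match fintype.split P with inl p => e \ox d p | inr p => - (z \ox d p) end.

Lemma sum_gram_vectors (u w : 'rV[C]_n) :
  \sum_P row_mx u w 0 P *: G P = e \ox u - z \ox w.
Proof.
have Gl i : G (lshift n i) = e \ox d i by rewrite /G (unsplitK (inl i)).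
have Gr i : G (rshift n i) = - (z \ox d i) by rewrite /G (unsplitK (inr i)).
rewrite big_split_ord /= [in RHS](row_sum_delta u) [in RHS](row_sum_delta w).
rewrite !mulmx_sumr -sumrN; congr (_ + _); apply: eq_bigr => i _.
  by rewrite row_mxEl Gl scalemxAr.
by rewrite row_mxEr Gr scalerN scalemxAr.
Qed.

Lemma gramE P Q : N P Q = H (G P) (G Q).
Proof.
rewrite -[P]splitK -[Q]splitK /G !unsplitK /N.
case: (fintype.split P) => p; case: (fintype.split Q) => q /=.
- by rewrite block_mxEul mxE.
- by rewrite block_mxEur !mxE !Hr.
- by rewrite block_mxEdl !mxE !Hl.
- by rewrite block_mxEdr !mxE !Hl !Hr opprK.
Qed.

Lemma row_gram (u w : 'rV[C]_n) Q :
  (row_mx u w *m N) 0 Q = H (e \ox u - z \ox w) (G Q).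
Proof.
rewrite -sum_gram_vectors (form_suml Hlin) mxE; apply: eq_bigr => P _.
by rewrite Hl gramE.
Qed.

Lemma mulmx_gram (u w u' w' : 'rV[C]_n) :
  (row_mx u w *m N *m (row_mx u' w')^t*) 0 0 =
  H (e \ox u - z \ox w) (e \ox u' - z \ox w').
Proof.
rewrite -[in RHS]sum_gram_vectors -(sum_gram_vectors u' w') (form_sumr Hlin Hherm) mxE.
apply: eq_bigr => Q _; rewrite Hr row_gram sum_gram_vectors mulrC; congr (_ * _).
by rewrite !mxE.
Qed.

(* The rows of row_mx K1 K2 form an orthonormal basis of the coefficients
   (u, w) for which e (x) u - z (x) w is symmetric, spanned by (e, 0), (0, z)
   and (z, -e), of square lengths 2, 2 and 4. *)
Let c : C := (sqrtC 2)^-1.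
Let cc : c * c = 1 / 2.
Proof. by rewrite /c -invfM -expr2 sqrtCK mul1r. Qed.
Let cb : c^* = c.
Proof. by rewrite geC0_conj // invr_ge0 sqrtC_ge0 ler0n. Qed.

Let k1 : seq 'rV[C]_n := [:: c *: e; 0; 2^-1 *: z].
Let k2 : seq 'rV[C]_n := [:: 0; c *: z; - (2^-1 *: e)].
Let K1 := \matrix_(i < 3) nth 0 k1 i.
Let K2 := \matrix_(i < 3) nth 0 k2 i.
Local Notation J := (symp C n).

Lemma J_mul : row_mx K1 K2 *m J = row_mx (- K2) K1.
Proof. by rewrite /symp mul_row_block !mulmx0 !mulmx1 mulmxN mulmx1 add0r addr0. Qed.

Lemma degenerate_directions (i : 'I_3) Q :
  H (e \ox nth 0 k1 i - z \ox nth 0 k2 i) (G Q) = 0.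
Proof.
apply: form_sym0; rewrite linearB /= !tr_tens.
by case: i => [[|[|[|//]]] ?] /=; apply/matrixP => i j;
  rewrite !mxE !big_ord1 !mxE; ring.
Qed.

(** The sum is |H(z (x) e, .)|^2 plus the trace of N (J N^T J^T), to which
    the symplectic trace lemma applies. *)
Lemma isotropic_reaction_ge0 :
  0 <= \sum_(p < n) \sum_(q < n)
    (H (z \ox e) (d p \ox d q) * (H (z \ox e) (d p \ox d q))^*
     + 2 * (H (z \ox d p) (z \ox d q) * H (e \ox d p) (e \ox d q))
     - 2 * (H (z \ox d p) (e \ox d q) * H (e \ox d p) (z \ox d q))).
Proof.
have NJ : 0 <= \tr (N *m (J *m N^T *m J^T)).
  apply: (@symplectic_trace_ge0 _ _ 3 N J (row_mx K1 K2)).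
  - by apply/matrixP => P Q; rewrite [LHS]mxE [N^T _ _]mxE !gramE /= -Hherm.
  - by rewrite /symp map_block_mx map_mxN map_mx1 map_mx0.
  - by rewrite /symp tr_block_mx opp_block_mx !linearN /= !trmx1 !trmx0 !oppr0 opprK.
  - rewrite /symp tr_block_mx mulmx_block linearN /= !trmx1 !trmx0 !mulmx0 !mul0mx.
    by rewrite !mulmx1 mulNmx mulmxN opprK mul1mx !add0r addr0 -scalar_mx_block.
  - apply/row_matrixP => i; rewrite row_mul row0 row_row_mx !rowK.
    by apply/rowP => Q; rewrite row_gram degenerate_directions mxE.
  - rewrite J_mul tr_row_mx mul_row_col mulNmx.
    apply/matrixP => i j; rewrite mxE [X in X + _]mxE !mulmx_rows mxE.
    by case: i j => [[|[|[|//]]] ?] [[|[|[|//]]] ?] /=;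
      rewrite !dotrE ?zz ?ee ?ze ?ez; ring.
  - rewrite tr_row_mx map_col_mx mul_row_col.
    have conj_rows k (f : 'I_k -> 'rV[C]_n) :
        (\matrix_i f i)^t* = (\matrix_i (f i)^cj)^T.
      by apply/matrixP => i j; rewrite !mxE.
    rewrite !conj_rows.
    apply/matrixP => i j; rewrite mxE !mulmx_rows mxE.
    by case: i j => [[|[|[|//]]] ?] [[|[|[|//]]] ?] /=;
      rewrite ?map_mxN ?map_mxZ ?map_mx0 !dotrE /= ?cb ?zzb ?eeb ?zeb ?ezb
        ?mulrA ?cc ?rmorphV ?rmorph_nat ?unitfE ?pnatr_eq0 //; field.
  - move=> x; rewrite -[x]hsubmxK; move: (lsubmx x) (rsubmx x) => u w.
    rewrite mulmx_gram J_mul tr_row_mx mul_row_col => /matrixP Kx.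
    have Ki (i : 'I_3) : dotr (nth 0 k1 i) w - dotr (nth 0 k2 i) u = 0.
      have := Kx i 0.
      by rewrite mulNmx mxE [X in X + _]mxE !mulmx_rows_tr mxE addrC.
    have c0 : c != 0 by rewrite invr_eq0 sqrtC_eq0 pnatr_eq0.
    have := Ki 0; have := Ki 1; have := Ki ord_max.
    rewrite /= !dotrE subr0 sub0r => K2' /eqP K1' /eqP K0'.
    move: K1' K0'; rewrite oppr_eq0 !mulf_eq0 (negPf c0) /= => /eqP zu /eqP ew.
    have -> : e \ox u - z \ox w = - (u \ox e + z \ox w) + (e \ox u + u \ox e).
      by rewrite opprD [RHS]addrC addrA addrK.
    rewrite form_modsym; last by rewrite linearD /= !tr_tens addrC.
    rewrite (formNl Hlin) (formNr Hlin Hherm) opprK.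
    apply: tangent_ge0; rewrite 1?dotrC //.
    apply: (@mulfI _ 2^-1); first by rewrite invr_eq0 pnatr_eq0.
    by rewrite mulr0 -[RHS]K2'; ring.
have trE : \tr (N *m (J *m N^T *m J^T)) = 2 * \sum_(p < n) \sum_(q < n)
   (H (z \ox d p) (z \ox d q) * H (e \ox d p) (e \ox d q)
    - H (z \ox d p) (e \ox d q) * H (e \ox d p) (z \ox d q)).
  rewrite mxtrace_symp_block; congr (_ * _).
  by apply: eq_bigr => p _; apply: eq_bigr => q _; rewrite !mxE.
under eq_bigr => p _ do under eq_bigr => q _ do rewrite -addrA -mulrBr.
under eq_bigr => p _ do rewrite big_split -mulr_sumr /=.
rewrite big_split -mulr_sumr /= -trE addr_ge0 //.
by do 2!apply: sumr_ge0 => ? _; exact: mul_conjC_ge0.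
Qed.

End IsotropicPlane.

(** * Complexification of a curvature tensor *)

(** The real part of X(z, w, zb, wb) for z = e1 + i e2 and w = e3 + i e4.
    For a curvature tensor the Bianchi identity turns the last four terms
    into -2 X e1 e2 e3 e4; this form is the one compatible with [curvQ] term
    by term. *)
Definition isotropic_sum (R : realType) n (X : form4 R n) e1 e2 e3 e4 : R :=
  X e1 e3 e1 e3 + X e1 e4 e1 e4 + X e2 e3 e2 e3 + X e2 e4 e2 e4
  - X e1 e3 e2 e4 - X e2 e4 e1 e3 + X e1 e4 e2 e3 + X e2 e3 e1 e4.

Section Complexify.
Variables (R : realType) (n : nat).
Local Notation C := (R[i]).

Lemma conj_complex (a b : R) : (a +i* b : C)^* = a +i* (- b).
Proof. by []. Qed.

Lemma sum_complex I (r : seq I) (P : pred I) (f g : I -> R) :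
  \sum_(i <- r | P i) (f i +i* g i : C) =
  (\sum_(i <- r | P i) f i) +i* (\sum_(i <- r | P i) g i).
Proof. by elim/big_rec3: _ => [|i x y z _ ->]. Qed.

Definition cmx m k (P Q : 'M[R]_(m, k)) : 'M[C]_(m, k) :=
  \matrix_(i, j) (P i j +i* Q i j).

Lemma cmxP m k (M : 'M[C]_(m, k)) :
  M = cmx (map_mx (@complex.Re R) M) (map_mx (@complex.Im R) M).
Proof. by apply/matrixP => i j; rewrite !mxE; case: (M i j). Qed.

Lemma cmx_tens (x1 x2 y1 y2 : 'rV[R]_n) :
  cmx x1 x2 \ox cmx y1 y2 =
  cmx (x1 \ox y1 - x2 \ox y2) (x1 \ox y2 + x2 \ox y1).
Proof. by apply/matrixP => i j; rewrite !mxE !big_ord1 !mxE. Qed.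

Lemma dotr_cmx (x1 x2 y1 y2 : 'rV[R]_n) :
  dotr (cmx x1 x2) (cmx y1 y2) =
  (dotr x1 y1 - dotr x2 y2) +i* (dotr x1 y2 + dotr x2 y1).
Proof.
rewrite /dotr -sumrB -big_split -sum_complex.
by apply: eq_bigr => i _; rewrite !mxE.
Qed.

Lemma conj_cmx m k (P Q : 'M[R]_(m, k)) :
  map_mx (@Num.conj C) (cmx P Q) = cmx P (- Q).
Proof. by apply/matrixP => i j; rewrite !mxE. Qed.

Variable A : form4 R n.
Hypothesis hA : algebraic_curvature_tensor A.

Let a (p q : 'I_n * 'I_n) : R :=
  A (delta_mx 0 p.1) (delta_mx 0 p.2) (delta_mx 0 q.1) (delta_mx 0 q.2).

Definition rform (M M' : 'M[R]_n) : R :=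
  \sum_p \sum_q M p.1 p.2 * M' q.1 q.2 * a p q.

Definition cform (M M' : 'M[C]_n) : C :=
  \sum_p \sum_q M p.1 p.2 * (M' q.1 q.2)^* * (a p q)%:C%C.

Lemma scalar_sum (f : 'rV[R]_n -> R) x : scalar f ->
  f x = \sum_i x 0 i * f (delta_mx 0 i).
Proof.
move=> fl.
have f0 : f 0 = 0.
  have := fl 1 0 0; rewrite scale1r mul1r addr0 => h.
  by apply: (addIr (f 0)); rewrite -h add0r.
rewrite [x in LHS](row_sum_delta x).
elim/big_rec2: _ => [//|i y1 y2 _ <-].
by rewrite fl.
Qed.

Lemma rform_tens x y z w : rform (x \ox y) (z \ox w) = A x y z w.
Proof.
rewrite (scalar_sum x (act_linear1 hA y z w)) /rform.
rewrite -(pair_big predT predT (fun i j => \sum_q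
  (x \ox y) i j * (z \ox w) q.1 q.2 * a (i, j) q)) /=.
apply: eq_bigr => i _; rewrite (scalar_sum y (act_linear2 hA _ z w)) mulr_sumr.
apply: eq_bigr => j _.
rewrite -(pair_big predT predT (fun k l =>
  (x \ox y) i j * (z \ox w) k l * a (i, j) (k, l))) /=.
rewrite (scalar_sum z (act_linear3 hA _ _ w)) !mulr_sumr.
apply: eq_bigr => k _; rewrite (scalar_sum w (act_linear4 hA _ _ _)) !mulr_sumr.
by apply: eq_bigr => l _; rewrite !mxE !big_ord1 !mxE /a /=; ring.
Qed.

Lemma cform_cmx P Q P' Q' : cform (cmx P Q) (cmx P' Q') =
  (rform P P' + rform Q Q') +i* (rform Q P' - rform P Q').
Proof.
rewrite /rform -sumrB -big_split -sum_complex; apply: eq_bigr => p _.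
rewrite -sumrB -big_split -sum_complex; apply: eq_bigr => q _.
by rewrite !mxE /= conj_complex; congr (_ +i* _); rewrite /=; ring.
Qed.

Lemma cform_linear M' : scalar (cform^~ M').
Proof.
move=> c M N; rewrite /cform mulr_sumr -big_split; apply: eq_bigr => p _ /=.
rewrite mulr_sumr -big_split; apply: eq_bigr => q _ /=.
by rewrite !mxE; ring.
Qed.

Lemma cform_herm M M' : cform M' M = (cform M M')^*.
Proof.
rewrite /cform rmorph_sum exchange_big; apply: eq_bigr => p _ /=.
rewrite rmorph_sum; apply: eq_bigr => q _ /=.
rewrite !rmorphM /= conjCK /a act_pair //.
have -> : (A (delta_mx 0 p.1) (delta_mx 0 p.2) (delta_mx 0 q.1) (delta_mx 0 q.2))%:C%C^* =
  (A (delta_mx 0 p.1) (delta_mx 0 p.2) (delta_mx 0 q.1) (delta_mx 0 q.2))%:C%C :> C.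
  by rewrite conj_complex oppr0.
by rewrite [_^* * _]mulrC.
Qed.

Lemma cform_skew M M' : cform M^T M' = - cform M M'.
Proof.
pose sw (p : 'I_n * 'I_n) := (p.2, p.1).
have swI : injective sw by move=> [i j] [k l] [-> ->].
rewrite /cform (reindex_inj swI) /= -sumrN.
apply: eq_bigr => p _; rewrite -sumrN; apply: eq_bigr => q _ /=.
by rewrite mxE /a /= act_skew12 //; rewrite rmorphN /= mulrN.
Qed.

Lemma isotropic_sumE e1 e2 e3 e4 : isotropic_sum A e1 e2 e3 e4 =
  A e1 e3 e1 e3 + A e1 e4 e1 e4 + A e2 e3 e2 e3 + A e2 e4 e2 e4 - 2 * A e1 e2 e3 e4.
Proof.
rewrite /isotropic_sum (act_pair hA e2 e4 e1 e3) (act_pair hA e1 e4 e2 e3).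
have := act_bianchi hA e1 e2 e3 e4.
rewrite (act_skew12 hA e3 e1) => h; lra.
Qed.

Lemma rformDl M N M' : rform (M + N) M' = rform M M' + rform N M'.
Proof.
rewrite -big_split; apply: eq_bigr => p _; rewrite -big_split.
by apply: eq_bigr => q _ /=; rewrite mxE; ring.
Qed.

Lemma rformDr M N M' : rform M' (M + N) = rform M' M + rform M' N.
Proof.
rewrite -big_split; apply: eq_bigr => p _; rewrite -big_split.
by apply: eq_bigr => q _ /=; rewrite mxE; ring.
Qed.

Lemma rformNl M M' : rform (- M) M' = - rform M M'.
Proof.
rewrite -sumrN; apply: eq_bigr => p _; rewrite -sumrN.
by apply: eq_bigr => q _ /=; rewrite mxE; ring.
Qed.

Lemma rformNr M M' : rform M' (- M) = - rform M' M.
Proof.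
rewrite -sumrN; apply: eq_bigr => p _; rewrite -sumrN.
by apply: eq_bigr => q _ /=; rewrite mxE; ring.
Qed.

Definition rformE := (rformDl, rformDr, rformNl, rformNr, rform_tens).

Lemma cform_tens x1 x2 y1 y2 z1 z2 w1 w2 :
  cform (cmx x1 x2 \ox cmx y1 y2) (cmx z1 z2 \ox cmx w1 w2) =
  (A x1 y1 z1 w1 - A x1 y1 z2 w2 - A x2 y2 z1 w1 + A x2 y2 z2 w2
   + A x1 y2 z1 w2 + A x1 y2 z2 w1 + A x2 y1 z1 w2 + A x2 y1 z2 w1)
  +i* (A x1 y2 z1 w1 - A x1 y2 z2 w2 + A x2 y1 z1 w1 - A x2 y1 z2 w2
   - A x1 y1 z1 w2 - A x1 y1 z2 w1 + A x2 y2 z1 w2 + A x2 y2 z2 w1).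
Proof.
rewrite !cmx_tens cform_cmx !rformE; congr (_ +i* _); ring.
Qed.

Lemma act_eq0 x y z w : [|| x == 0, y == 0, z == 0 | w == 0] -> A x y z w = 0.
Proof.
have s0 (f : 'rV[R]_n -> R) : scalar f -> f 0 = 0.
  by move=> fl; rewrite (scalar_sum 0 fl) big1 // => i _; rewrite mxE mul0r.
case/or4P => /eqP ->.
- exact: (s0 _ (act_linear1 hA y z w)).
- exact: (s0 _ (act_linear2 hA x z w)).
- exact: (s0 _ (act_linear3 hA x y w)).
- exact: (s0 _ (act_linear4 hA x y z)).
Qed.

Lemma actZ c d x y z w : A (c *: x) (d *: y) (c *: z) (d *: w) =
  c ^+ 2 * d ^+ 2 * A x y z w.
Proof.
by rewrite -(rform_tens (c *: x)) -(rform_tens x) /rform;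
  rewrite mulr_sumr; apply: eq_bigr => p _; rewrite mulr_sumr;
  apply: eq_bigr => q _; rewrite !mxE !big_ord1 !mxE; ring.
Qed.

Hypothesis hN : nonneg_isotropic_curvature A.

Lemma dotr_eq0 (x : 'rV[R]_n) : dotr x x = 0 -> x = 0.
Proof.
move=> /eqP; rewrite psumr_eq0; last by move=> i _; rewrite -expr2 sqr_ge0.
move=> /allP h; apply/rowP => i; rewrite mxE; apply/eqP.
by have := h i (mem_index_enum i); rewrite /= mulf_eq0 orbb.
Qed.

Lemma dotr_ge0 (x : 'rV[R]_n) : 0 <= dotr x x.
Proof. by apply: sumr_ge0 => i _; rewrite -expr2 sqr_ge0. Qed.

(** Four-frames that are orthogonal with equal lengths in each of the two
    pairs reduce to orthonormal ones by scaling. *)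
Lemma isotropic_sum_ge0 x1 x2 y1 y2 :
  dotr x1 x1 = dotr x2 x2 -> dotr x1 x2 = 0 ->
  dotr y1 y1 = dotr y2 y2 -> dotr y1 y2 = 0 ->
  dotr x1 y1 = 0 -> dotr x1 y2 = 0 -> dotr x2 y1 = 0 -> dotr x2 y2 = 0 ->
  0 <= isotropic_sum A x1 x2 y1 y2.
Proof.
move=> xx x12 yy y12 xy11 xy12 xy21 xy22.
have [x0|x0] := eqVneq (dotr x1 x1) 0.
  have -> := dotr_eq0 x0; have -> : x2 = 0 by apply: dotr_eq0; rewrite -xx.
  by rewrite /isotropic_sum !act_eq0 ?eqxx ?orbT //; lra.
have [y0|y0] := eqVneq (dotr y1 y1) 0.
  have -> := dotr_eq0 y0; have -> : y2 = 0 by apply: dotr_eq0; rewrite -yy.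
  by rewrite /isotropic_sum !act_eq0 ?eqxx ?orbT //; lra.
pose r := Num.sqrt (dotr x1 x1); pose s := Num.sqrt (dotr y1 y1).
have rr : dotr x1 x1 = r ^+ 2 by rewrite sqr_sqrtr ?dotr_ge0.
have ss : dotr y1 y1 = s ^+ 2 by rewrite sqr_sqrtr ?dotr_ge0.
have r0 : r != 0 by move: x0; rewrite rr expf_eq0.
have s0 : s != 0 by move: y0; rewrite ss expf_eq0.
have fr : orthonormal_family [:: r^-1 *: x1; r^-1 *: x2; s^-1 *: y1; s^-1 *: y2].
  move=> i j; rewrite -[dotv]/(@dotr R n).
  have sym := (dotrC x2 x1, dotrC y2 y1, dotrC y1 x1, dotrC y2 x1,
              dotrC y1 x2, dotrC y2 x2).
  by case: i => [|[|[|[|//]]]] _; case: j => [|[|[|[|//]]]] _ /=;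
    rewrite !dotrE ?sym -?xx -?yy ?x12 ?y12 ?xy11 ?xy12 ?xy21 ?xy22 ?rr ?ss;
    rewrite ?mulr0 //=; field; rewrite ?r0 ?s0.
have := hN fr; rewrite -isotropic_sumE.
have -> : isotropic_sum A (r^-1 *: x1) (r^-1 *: x2) (s^-1 *: y1) (s^-1 *: y2) =
   (r^-1 ^+ 2 * s^-1 ^+ 2) * isotropic_sum A x1 x2 y1 y2.
  by rewrite /isotropic_sum !actZ; ring.
by rewrite pmulr_rge0 // mulr_gt0 // exprn_even_gt0 //= invr_eq0.
Qed.

Lemma cform_iso x1 x2 y1 y2 :
  cform (cmx x1 x2 \ox cmx y1 y2) (cmx x1 x2 \ox cmx y1 y2) =
  isotropic_sum A x1 x2 y1 y2 +i* 0.
Proof.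
rewrite cform_tens /isotropic_sum; congr (_ +i* _).
  by rewrite (act_pair hA x2 y2 x1 y1) (act_pair hA x2 y1 x1 y2); ring.
rewrite (act_pair hA x1 y2 x1 y1) (act_pair hA x1 y2 x2 y2) (act_pair hA x2 y1 x1 y1).
by rewrite (act_pair hA x2 y1 x2 y2); ring.
Qed.

Lemma complex_eqP (u v u' v' : R) : (u +i* v : C) = u' +i* v' -> u = u' /\ v = v'.
Proof. by case=> -> ->. Qed.

(** Subtracting from y its component along x does not change the bivector of
    x and y and makes y orthogonal to x in the Hermitian sense too; the real
    and imaginary parts of x and y then form an orthogonal four-frame. *)
Lemma cform_isotropic_ge0 (x y : 'rV[C]_n) :
  dotr x x = 0 -> dotr x y = 0 -> dotr y y = 0 ->
  0 <= cform (x \ox y) (x \ox y).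
Proof.
move=> xx xy yy.
pose xb := map_mx (@Num.conj C) x.
pose c := dotr y xb / dotr x xb; pose y' := y - c *: x.
have -> : x \ox y = x \ox y' + c *: (x \ox x).
  by apply/matrixP => i j; rewrite !mxE !big_ord1 !mxE; ring.
rewrite (form_modsym cform_linear cform_herm cform_skew); last first.
  by rewrite linearZ /= trmx_mul trmxK.
have xy' : dotr x y' = 0 by rewrite /y' !dotrE xy xx; ring.
have yy' : dotr y' y' = 0 by rewrite /y' !dotrE yy xx (dotrC y) xy; ring.
have [x0|x0] := eqVneq (dotr x xb) 0; last first.
  have xby' : dotr xb y' = 0.
    by rewrite /y' !dotrE (dotrC xb y) (dotrC xb x) /c; field.
  move: xx xy' yy' xby'; rewrite /xb [x]cmxP [y']cmxP conj_cmx !dotr_cmx !dotrE.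
  move: (map_mx (@complex.Re R) x) (map_mx (@complex.Im R) x) => x1 x2.
  move: (map_mx (@complex.Re R) y') (map_mx (@complex.Im R) y') => y1 y2.
  rewrite (dotrC x2 x1) (dotrC y2 y1).
  move=> /complex_eqP[h1 h2] /complex_eqP[h3 h4] /complex_eqP[h5 h6] /complex_eqP[h7 h8].
  rewrite cform_iso lecE /= eqxx /=.
  by apply: isotropic_sum_ge0; lra.
suff -> : x = 0 by rewrite trmx0 mul0mx (form0l cform_linear).
move: x0; rewrite /xb [x]cmxP conj_cmx dotr_cmx !dotrE => /complex_eqP[h _].
have h1 := dotr_ge0 (map_mx (@complex.Re R) x).
have h2 := dotr_ge0 (map_mx (@complex.Im R) x).
have -> : map_mx (@complex.Re R) x = 0 by apply: dotr_eq0; lra.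
have -> : map_mx (@complex.Im R) x = 0 by apply: dotr_eq0; lra.
by apply/matrixP => i j; rewrite !mxE.
Qed.

Lemma delta_cmx p : delta_mx 0 p = cmx (delta_mx 0 p) 0 :> 'rV[C]_n.
Proof. by apply/rowP => i; rewrite !mxE eqxx /=; case: (i == p). Qed.

Local Notation dC p := (delta_mx 0 p : 'rV[C]_n).
Local Notation dR p := (delta_mx 0 p : 'rV[R]_n).

Lemma cform_deltal (x1 x2 y1 y2 : 'rV[R]_n) (p q : 'I_n) :
  cform (cmx x1 x2 \ox dC p) (cmx y1 y2 \ox dC q) =
  (A x1 (dR p) y1 (dR q) + A x2 (dR p) y2 (dR q))
  +i* (A x2 (dR p) y1 (dR q) - A x1 (dR p) y2 (dR q)).
Proof.
rewrite !delta_cmx cform_tens.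
rewrite !(@act_eq0 _ 0) ?(@act_eq0 _ _ _ 0) ?eqxx ?orbT //.
by congr (_ +i* _); ring.
Qed.

Lemma cform_deltar (x1 x2 y1 y2 : 'rV[R]_n) (p q : 'I_n) :
  cform (cmx x1 x2 \ox cmx y1 y2) (dC p \ox dC q) =
  (A x1 y1 (dR p) (dR q) - A x2 y2 (dR p) (dR q))
  +i* (A x1 y2 (dR p) (dR q) + A x2 y1 (dR p) (dR q)).
Proof.
rewrite !delta_cmx cform_tens.
rewrite !(@act_eq0 _ _ 0) ?(@act_eq0 _ _ _ 0) ?eqxx ?orbT //.
by congr (_ +i* _); ring.
Qed.

Lemma Re_sum (I : finType) (f : I -> C) :
  complex.Re (\sum_i f i) = \sum_i complex.Re (f i).
Proof. by elim/big_rec2: _ => [//|i x y _ <-]; case: (f i) y => [? ?] []. Qed.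

(** At the boundary of the cone [curvQ A] points inwards: this is
    [isotropic_reaction_ge0] for the Hermitian form of A, the summands of both
    sides being equal for each p and q. *)
Lemma curvQ_isotropic_ge0 e1 e2 e3 e4 :
  orthonormal_family [:: e1; e2; e3; e4] ->
  isotropic_sum A e1 e2 e3 e4 = 0 ->
  0 <= isotropic_sum (curvQ A) e1 e2 e3 e4.
Proof.
move=> fr A0.
have dE i j (hi : (i < 4)%N) (hj : (j < 4)%N) :
  dotr (nth 0 [:: e1; e2; e3; e4] i) (nth 0 [:: e1; e2; e3; e4] j) = (i == j)%:R
  := fr i j hi hj.
have d11 := dE 0%N 0%N isT isT; have d12 := dE 0%N 1%N isT isT.
have d13 := dE 0%N 2%N isT isT; have d14 := dE 0%N 3%N isT isT.
have d22 := dE 1%N 1%N isT isT; have d23 := dE 1%N 2%N isT isT.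
have d24 := dE 1%N 3%N isT isT; have d33 := dE 2%N 2%N isT isT.
have d34 := dE 2%N 3%N isT isT; have d44 := dE 3%N 3%N isT isT.
rewrite /= in d11 d12 d13 d14 d22 d23 d24 d33 d34 d44.
have := @isotropic_reaction_ge0 _ n cform cform_linear cform_herm cform_skew
  cform_isotropic_ge0 (cmx e1 e2) (cmx e3 e4).
rewrite !conj_cmx !dotr_cmx !dotrE (dotrC e2 e1) (dotrC e4 e3).
rewrite d11 d12 d13 d14 d22 d23 d24 d33 d34 d44 cform_iso A0.
have E (u v u' v' : R) : u = u' -> v = v' -> (u +i* v : C) = u' +i* v' by move=> -> ->.
have two : ((1 - - 1) +i* (- 0 + 0) : C) = 2.
  by rewrite -[2]/(1 + 1 : C); apply: E; lra.
have zer : ((1 - 1) +i* (0 + 0) : C) = 0 by apply: E; lra.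
have zer1 : ((0 - 0) +i* (0 + 0) : C) = 0 by apply: E; lra.
have zer2 : ((0 - - 0) +i* (- 0 + 0) : C) = 0 by apply: E; lra.
move=> /(_ zer zer zer1 two two zer2 erefl).
rewrite lecE => /andP[_]; rewrite /= => /le_trans; apply.
rewrite Re_sum /isotropic_sum /curvQ -!(big_split, sumrB) /=; apply: ler_sum => p _.
rewrite Re_sum -!(big_split, sumrB) /=; apply: ler_sum => q _.
rewrite !cform_deltal cform_deltar conj_complex.
rewrite -[2]/(1 + 1 : C) /=.
set e := delta_mx 0.
by rewrite le_eqVlt; apply/orP; left; apply/eqP; ring.
Qed.

End Complexify.

(** * Norms of forms and the Lipschitz bound for the reaction term *)

Section Bounds.
Variables (R : realType) (n : nat).
Implicit Types (A B : form4 R n) (x y z w e : 'rV[R]_n).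

Definition form_axpy A (c : R) B : form4 R n :=
  fun x y z w => A x y z w + c * B x y z w.

Lemma act_axpy A c B : algebraic_curvature_tensor A ->
  algebraic_curvature_tensor B -> algebraic_curvature_tensor (form_axpy A c B).
Proof.
move=> hA hB; rewrite /form_axpy; split.
- by move=> y z w k u v; rewrite (act_linear1 hA) (act_linear1 hB); ring.
- by move=> x z w k u v; rewrite (act_linear2 hA) (act_linear2 hB); ring.
- by move=> x y w k u v; rewrite (act_linear3 hA) (act_linear3 hB); ring.
- by move=> x y z k u v; rewrite (act_linear4 hA) (act_linear4 hB); ring.
- by move=> x y z w; rewrite (act_skew12 hA) (act_skew12 hB); ring.
- by move=> x y z w; rewrite (act_skew34 hA) (act_skew34 hB); ring.
- by move=> x y z w; rewrite (act_pair hA) (act_pair hB).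
- move=> x y z w; have := act_bianchi hA x y z w; have := act_bianchi hB x y z w.
  move: (A x y z w) (A y z x w) (A z x y w) => a1 a2 a3.
  move: (B x y z w) (B y z x w) (B z x y w) => b1 b2 b3 hb ha.
  rewrite (_ : _ + _ = (a1 + a2 + a3) + c * (b1 + b2 + b3)); last by ring.
  by rewrite ha hb mulr0 addr0.
Qed.

Definition sphere_curv : form4 R n :=
  fun x y z w => dotr x z * dotr y w - dotr x w * dotr y z.

Lemma sphere_act : algebraic_curvature_tensor sphere_curv.
Proof.
rewrite /sphere_curv; split.
- by move=> y z w k u v; rewrite !dotrE; ring.
- by move=> x z w k u v; rewrite !dotrE; ring.
- by move=> x y w k u v; rewrite !dotrE; ring.
- by move=> x y z k u v; rewrite !dotrE; ring.
- by move=> x y z w; ring.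
- by move=> x y z w; ring.
- by move=> x y z w; rewrite (dotrC z) (dotrC w) (dotrC z y) (dotrC w x); ring.
- by move=> x y z w; rewrite (dotrC z x) (dotrC z y) (dotrC y x); ring.
Qed.

Lemma orthonormal_dotr e1 e2 e3 e4 : orthonormal_family [:: e1; e2; e3; e4] ->
  [/\ dotr e1 e1 = 1, dotr e2 e2 = 1, dotr e3 e3 = 1 & dotr e4 e4 = 1] /\
  [/\ dotr e1 e2 = 0, dotr e3 e4 = 0 &
   [/\ dotr e1 e3 = 0, dotr e1 e4 = 0, dotr e2 e3 = 0 & dotr e2 e4 = 0]].
Proof.
move=> fr; pose s := [:: e1; e2; e3; e4].
have dE i j (hi : (i < 4)%N) (hj : (j < 4)%N) : dotr (nth 0 s i) (nth 0 s j) = (i == j)%:R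
  := fr i j hi hj.
split; first split; [exact: (dE 0%N 0%N)|exact: (dE 1%N 1%N)|exact: (dE 2%N 2%N)
  |exact: (dE 3%N 3%N)|].
split; [exact: (dE 0%N 1%N)|exact: (dE 2%N 3%N)|].
split; [exact: (dE 0%N 2%N)|exact: (dE 0%N 3%N)|exact: (dE 1%N 2%N)|exact: (dE 1%N 3%N)].
Qed.

Lemma sphere_isotropic e1 e2 e3 e4 : orthonormal_family [:: e1; e2; e3; e4] ->
  isotropic_sum sphere_curv e1 e2 e3 e4 = 4.
Proof.
move=> /orthonormal_dotr[[d11 d22 d33 d44] [d12 d34 [d13 d14 d23 d24]]].
rewrite /isotropic_sum /sphere_curv
  (dotrC e3 e1) (dotrC e4 e1) (dotrC e3 e2) (dotrC e4 e2)
  (dotrC e4 e3) (dotrC e2 e1) d11 d22 d33 d44 d12 d34 d13 d14 d23 d24; ring.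
Qed.

Lemma isotropic_sum_axpy A c B e1 e2 e3 e4 :
  isotropic_sum (form_axpy A c B) e1 e2 e3 e4 =
  isotropic_sum A e1 e2 e3 e4 + c * isotropic_sum B e1 e2 e3 e4.
Proof. by rewrite /isotropic_sum /form_axpy; ring. Qed.

(** A convenient set of arguments: it contains the vectors of orthonormal
    frames and the standard basis vectors summed over in [curvQ]. *)
Definition cube x := forall i, `|x 0 i| <= 1.

Lemma cube_delta i : cube (delta_mx 0 i).
Proof. by move=> j; rewrite mxE /=; case: (j == i); rewrite ?normr1 // normr0. Qed.

Lemma cube_dotr x : dotr x x = 1 -> cube x.
Proof.
move=> x1 i; rewrite -(@expr_le1 _ 2) // -normrX ger0_norm ?sqr_ge0 // -x1.
rewrite /dotr (bigD1 i) //= expr2 lerDl.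
by apply: sumr_ge0 => j _; rewrite -expr2 sqr_ge0.
Qed.

Definition form_norm A : R :=
  \sum_p \sum_q `|A (delta_mx 0 p.1) (delta_mx 0 p.2) (delta_mx 0 q.1) (delta_mx 0 q.2)|.

Lemma le_form_norm A x y z w : algebraic_curvature_tensor A ->
  cube x -> cube y -> cube z -> cube w -> `|A x y z w| <= form_norm A.
Proof.
move=> hA hx hy hz hw; rewrite -(rform_tens hA) /rform.
apply: (le_trans (ler_norm_sum _ _ _)); apply: ler_sum => p _.
apply: (le_trans (ler_norm_sum _ _ _)); apply: ler_sum => q _.
rewrite !mxE !big_ord1 !mxE !normrM ler_piMl //.
by rewrite !mulr_ile1 // mulr_ge0.
Qed.

Lemma isotropic_sum_norm (X : form4 R n) M e1 e2 e3 e4 :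
  (forall x y z w, cube x -> cube y -> cube z -> cube w -> `|X x y z w| <= M) ->
  orthonormal_family [:: e1; e2; e3; e4] ->
  `|isotropic_sum X e1 e2 e3 e4| <= 8 * M.
Proof.
move=> XM /orthonormal_dotr[[/cube_dotr c1 /cube_dotr c2 /cube_dotr c3 /cube_dotr c4] _].
have h x y z w (hx : cube x) (hy : cube y) (hz : cube z) (hw : cube w) :
   - M <= X x y z w <= M by rewrite -ler_norml XM.
rewrite ler_norml /isotropic_sum.
have /andP[h1 h1'] := h e1 e3 e1 e3 c1 c3 c1 c3.
have /andP[h2 h2'] := h e1 e4 e1 e4 c1 c4 c1 c4.
have /andP[h3 h3'] := h e2 e3 e2 e3 c2 c3 c2 c3.
have /andP[h4 h4'] := h e2 e4 e2 e4 c2 c4 c2 c4.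
have /andP[h5 h5'] := h e1 e3 e2 e4 c1 c3 c2 c4.
have /andP[h6 h6'] := h e2 e4 e1 e3 c2 c4 c1 c3.
have /andP[h7 h7'] := h e1 e4 e2 e3 c1 c4 c2 c3.
have /andP[h8 h8'] := h e2 e3 e1 e4 c2 c3 c1 c4.
by apply/andP; split; lra.
Qed.

(** The factor 5 counts the products in a summand of [curvQ], with
    coefficients 1, 2 and 2. *)
Definition curvQ_modulus (M : R) : R :=
  5 * (2 * form_norm sphere_curv * M + form_norm sphere_curv ^+ 2) *+ n *+ n.

Lemma mul_perturb (a b i j d B M : R) :
  `|a| <= M -> `|b| <= M -> `|i| <= B -> `|j| <= B ->
  0 <= d <= 1 ->
  `|(a + d * i) * (b + d * j) - a * b| <= d * (2 * B * M + B ^+ 2).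
Proof.
move=> aM bM iB jB /andP[d0 d1].
have B0 : 0 <= B := le_trans (normr_ge0 _) iB.
have -> : (a + d * i) * (b + d * j) - a * b = d * (i * b + a * j + d * (i * j)) by ring.
rewrite normrM ger0_norm // ler_wpM2l //.
apply: (le_trans (ler_normD _ _)).
have h1 : `|i * b| <= B * M by rewrite normrM ler_pM.
have h2 : `|a * j| <= M * B by rewrite normrM ler_pM.
have h3 : `|d * (i * j)| <= B ^+ 2.
  by rewrite normrM ger0_norm // -[leRHS]mul1r expr2 ler_pM // normrM ler_pM.
have := ler_normD (i * b) (a * j); lra.
Qed.

Lemma curvQ_perturb A M d x y z w : algebraic_curvature_tensor A ->
  form_norm A <= M -> 0 <= d <= 1 -> cube x -> cube y -> cube z -> cube w ->
  `|curvQ (form_axpy A d sphere_curv) x y z w - curvQ A x y z w|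
    <= d * curvQ_modulus M.
Proof.
move=> hA AM hd cx cy cz cw.
set B := form_norm sphere_curv; set c0 := 2 * B * M + B ^+ 2.
have mul x1 y1 z1 w1 x2 y2 z2 w2 
  (h1 : cube x1) (h2 : cube y1) (h3 : cube z1) (h4 : cube w1)
  (h5 : cube x2) (h6 : cube y2) (h7 : cube z2) (h8 : cube w2) :
  `|form_axpy A d sphere_curv x1 y1 z1 w1 * form_axpy A d sphere_curv x2 y2 z2 w2
     - A x1 y1 z1 w1 * A x2 y2 z2 w2| <= d * c0.
  by apply: mul_perturb => //; first [exact: le_form_norm sphere_act _ _ _ _
     | exact: le_trans (le_form_norm hA _ _ _ _) AM].
have -> : d * curvQ_modulus M = \sum_(p < n) \sum_(q < n) (5 * (d * c0)).
  rewrite !sumr_const !card_ord /curvQ_modulus !mulrnAr -/B -/c0.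
  by congr (_ *+ _ *+ _); ring.
rewrite /curvQ -sumrB; apply: (le_trans (ler_norm_sum _ _ _)); apply: ler_sum => p _.
rewrite -sumrB; apply: (le_trans (ler_norm_sum _ _ _)); apply: ler_sum => q _.
have cp := cube_delta p; have cq := cube_delta q.
move: (delta_mx 0 p) (delta_mx 0 q) cp cq => ep eq cp cq.
have := mul x y ep eq z w ep eq cx cy cp cq cz cw cp cq.
have := mul x ep z eq y ep w eq cx cp cz cq cy cp cw cq.
have := mul x ep w eq y ep z eq cx cp cw cq cy cp cz cq.
rewrite !ler_norml => /andP[? ?] /andP[? ?] /andP[? ?].
by apply/andP; split; lra.
Qed.

End Bounds.

(** * Compactness of the set of orthonormal frames *)

Section Compactness.
Local Open Scope classical_set_scope.
Variables (R : realType) (n : nat) (T : topologicalType).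

Lemma continuous_sum (I : Type) (r : seq I) (F : I -> T -> R) :
  (forall i, continuous (F i)) -> continuous (fun p => \sum_(i <- r) F i p).
Proof.
by move=> Fc; apply: continuous_big => //; exact: add_continuous.
Qed.

Lemma continuous_mul (f g : T -> R) : continuous f -> continuous g ->
  continuous (fun p => f p * g p).
Proof. by move=> fc gc p; apply: cvgM; [exact: fc|exact: gc]. Qed.

Lemma continuous_coord (f : T -> 'rV[R]_n) i : continuous f ->
  continuous (fun p => f p 0 i).
Proof.
move=> fc p; apply: (@cvg_comp _ _ _ f (fun M : 'rV[R]_n => M 0 i)); first exact: fc.
exact: coord_continuous.
Qed.

Lemma continuous_dotr (f g : T -> 'rV[R]_n) : continuous f -> continuous g ->
  continuous (fun p => dotr (f p) (g p)).
Proof.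
by move=> fc gc; apply: continuous_sum => i;
  apply: continuous_mul; exact: continuous_coord.
Qed.

Lemma continuous_form (A : form4 R n) (f1 f2 f3 f4 : T -> 'rV[R]_n) :
  algebraic_curvature_tensor A -> continuous f1 -> continuous f2 ->
  continuous f3 -> continuous f4 ->
  continuous (fun p => A (f1 p) (f2 p) (f3 p) (f4 p)).
Proof.
move=> hA c1 c2 c3 c4.
under eq_fun do rewrite -(rform_tens hA) /rform.
apply: continuous_sum => -[i j]; apply: continuous_sum => -[k l] /=.
under eq_fun do rewrite !mxE !big_ord1 !mxE.
by do ?[exact: continuous_coord | apply: continuous_mul | exact: cst_continuous].
Qed.

End Compactness.

Section Frames.
Local Open Scope classical_set_scope.
Variables (R : realType) (n : nat).

Local Notation E4 := ('rV[R]_n * 'rV[R]_n * 'rV[R]_n * 'rV[R]_n)%type.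
Let pr (i : 'I_4) (p : E4) : 'rV[R]_n := nth 0 [:: p.1.1.1; p.1.1.2; p.1.2; p.2] i.

Lemma pr_continuous i : continuous (pr i).
Proof.
have c1 : continuous (fun p : E4 => p.1) by move=> p; exact: cvg_fst.
have c11 : continuous (fun p : E4 => p.1.1).
  by move=> p; apply: (@cvg_comp _ _ _ fst fst); [exact: c1|exact: cvg_fst].
case: i => [[|[|[|[|//]]]] hi]; rewrite /pr /= => p.
- by apply: (@cvg_comp _ _ _ (fun p : E4 => p.1.1) fst); [exact: c11|exact: cvg_fst].
- by apply: (@cvg_comp _ _ _ (fun p : E4 => p.1.1) snd); [exact: c11|exact: cvg_snd].
- by apply: (@cvg_comp _ _ _ (fun p : E4 => p.1) snd); [exact: c1|exact: cvg_snd].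
- exact: cvg_snd.
Qed.

Let frames : set E4 := [set p | orthonormal_family [:: p.1.1.1; p.1.1.2; p.1.2; p.2]].

Lemma frames_closed : closed frames.
Proof.
have -> : frames = \bigcap_(ij in [set: 'I_4 * 'I_4])
    [set p | dotr (pr ij.1 p) (pr ij.2 p) = (ij.1 == ij.2)%:R].
  apply/seteqP; split=> p /= fr.
    by move=> [i j] _ /=; exact: (fr i j (ltn_ord i) (ltn_ord j)).
  by move=> i j hi hj; have := fr (Ordinal hi, Ordinal hj) I.
apply: closed_bigI => -[i j] _ /=.
have c : continuous (fun p => dotr (pr i p) (pr j p)).
  by apply: continuous_dotr; exact: pr_continuous.
by apply: ((continuous_closedP _).1 c [set x | x = (i == j)%:R]); exact: closed_eq.
Qed.

Lemma cube_compact : compact [set x : 'rV[R]_n | cube x].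
Proof.
have -> : [set x : 'rV[R]_n | cube x] =
    [set v | forall i, (`[-1, 1]%classic : set R) (v ord0 i)].
  by apply/seteqP; split=> x /= h i; have := h i; rewrite /= in_itv /= ler_norml.
exact: (@rV_compact R n (fun=> `[-1, 1]%classic) (fun=> @segment_compact R (-1) 1)).
Qed.

Lemma frames_compact : compact frames.
Proof.
apply: (@subclosed_compact _ _
  (let Q := [set x | cube x] in ((Q `*` Q) `*` Q) `*` Q : set E4)).
- exact: frames_closed.
- by do 3!(apply: compact_setX; last exact: cube_compact); exact: cube_compact.
- move=> [[[e1 e2] e3] e4] /= /orthonormal_dotr[[h1 h2 h3 h4] _].
  by split=> /=; [split=> /=; [split|]|]; exact: cube_dotr.
Qed.

Lemma isotropic_sum_min (A : form4 R n) (e1 e2 e3 e4 : 'rV[R]_n) :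
  algebraic_curvature_tensor A -> orthonormal_family [:: e1; e2; e3; e4] ->
  exists f1 f2 f3 f4 : 'rV[R]_n, orthonormal_family [:: f1; f2; f3; f4] /\
    forall g1 g2 g3 g4 : 'rV[R]_n, orthonormal_family [:: g1; g2; g3; g4] ->
    isotropic_sum A f1 f2 f3 f4 <= isotropic_sum A g1 g2 g3 g4.
Proof.
move=> hA fr.
pose F (p : E4) := isotropic_sum A p.1.1.1 p.1.1.2 p.1.2 p.2.
have Fc : continuous F.
  have c i j k l := continuous_form hA (@pr_continuous i) (@pr_continuous j)
    (@pr_continuous k) (@pr_continuous l).
  pose o1 : 'I_4 := @Ordinal 4 0 isT; pose o2 : 'I_4 := @Ordinal 4 1 isT.
  pose o3 : 'I_4 := @Ordinal 4 2 isT; pose o4 : 'I_4 := @Ordinal 4 3 isT.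
  move=> p; rewrite /F /isotropic_sum.
  do ?[apply: cvgB|apply: cvgD].
  - exact: (c o1 o3 o1 o3).
  - exact: (c o1 o4 o1 o4).
  - exact: (c o2 o3 o2 o3).
  - exact: (c o2 o4 o2 o4).
  - exact: (c o1 o3 o2 o4).
  - exact: (c o2 o4 o1 o3).
  - exact: (c o1 o4 o2 o3).
  - exact: (c o2 o3 o1 o4).
have fr0 : frames !=set0 by exists (e1, e2, e3, e4).
have [[[[f1 f2] f3] f4] fin fmin] := compact_EVT_min fr0 frames_compact
  (continuous_subspaceT Fc).
exists f1, f2, f3, f4; split; first by rewrite inE in fin.
move=> g1 g2 g3 g4 fg; apply: (fmin (g1, g2, g3, g4)); by rewrite inE.
Qed.

End Frames.

(** * Maximum principle along the evolution *)

Section DeriveWithin.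
Local Open Scope classical_set_scope.
Variables (R : realType) (D : set R) (t : R).
Implicit Types (f g : R -> R) (l m e : R).

Lemma is_derive_withinD f g l m : is_derive_within D f t l ->
  is_derive_within D g t m -> is_derive_within D (fun s => f s + g s) t (l + m).
Proof.
move=> hf hg; rewrite /is_derive_within.
have -> : (fun s => (s - t)^-1 * (f s + g s - (f t + g t))) =
    (fun s => (s - t)^-1 * (f s - f t)) + (fun s => (s - t)^-1 * (g s - g t)).
  by apply/funext => s; rewrite fctE -mulrDr opprD addrACA.
exact: cvgD.
Qed.

Lemma is_derive_withinB f g l m : is_derive_within D f t l ->
  is_derive_within D g t m -> is_derive_within D (fun s => f s - g s) t (l - m).
Proof.
move=> hf hg; rewrite /is_derive_within.
have -> : (fun s => (s - t)^-1 * (f s - g s - (f t - g t))) =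
    (fun s => (s - t)^-1 * (f s - f t)) - (fun s => (s - t)^-1 * (g s - g t)).
  by apply/funext => s; rewrite fctE -mulrBr; congr (_ * _); ring.
exact: cvgB.
Qed.

Lemma is_derive_within_near f l e : is_derive_within D f t l -> 0 < e ->
  \forall s \near t, D s -> s != t -> `|f s - f t - l * (s - t)| <= e * `|s - t|.
Proof.
move=> hf e0; have /cvgrPdist_lt/(_ e e0) := hf.
rewrite near_withinE near_withinE; apply: filterS => s h Ds st.
have st0 : s - t != 0 by rewrite subr_eq0.
have := h st Ds; rewrite distrC => /ltW h'.
have -> : f s - f t - l * (s - t) = ((s - t)^-1 * (f s - f t) - l) * (s - t).
  by field.
by rewrite normrM ler_wpM2r.
Qed.

Lemma is_derive_within_lipschitz f l : is_derive_within D f t l ->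
  exists2 c, 0 <= c & \forall s \near t, D s -> `|f s - f t| <= c * `|s - t|.
Proof.
move=> hf; exists (1 + `|l|); first by rewrite addr_ge0.
have := is_derive_within_near hf ltr01; apply: filterS => s h Ds.
have [->|st] := eqVneq s t; first by rewrite !subrr normr0 mulr0.
have := h Ds st; have := ler_normD (f s - f t - l * (s - t)) (l * (s - t)).
rewrite subrK normrM; lra.
Qed.

End DeriveWithin.

Lemma form_norm_dist (R : realType) n (A B : form4 R n) :
  `|form_norm A - form_norm B| <= form_norm (form_axpy A (-1) B).
Proof.
rewrite /form_norm -sumrB; apply: (le_trans (ler_norm_sum _ _ _)).
apply: ler_sum => p _; rewrite -sumrB; apply: (le_trans (ler_norm_sum _ _ _)).
by apply: ler_sum => q _; rewrite /form_axpy mulN1r; exact: ler_dist_dist.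
Qed.

Section Evolution.
Local Open Scope classical_set_scope.
Variables (R : realType) (n : nat) (T : \bar R) (A : R -> form4 R n).
Hypothesis hA : curvature_ode_solution T A.
Let D := time_interval T.
Let act t (ht : D t) := (hA ht).1.
Let ode t (ht : D t) := (hA ht).2.

Lemma isotropic_sum_derive t e1 e2 e3 e4 : D t ->
  is_derive_within D (fun s => isotropic_sum (A s) e1 e2 e3 e4) t
    (isotropic_sum (curvQ (A t)) e1 e2 e3 e4).
Proof.
move=> ht; rewrite /isotropic_sum.
by do ?[apply: is_derive_withinB|apply: is_derive_withinD]; exact: ode.
Qed.

Lemma form_norm_lipschitz t : D t -> exists2 c, 0 <= c &
  \forall s \near t, D s -> form_norm (form_axpy (A s) (-1) (A t)) <= c * `|s - t|.
Proof.
move=> ht.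
pose P : finType := ('I_n * 'I_n * ('I_n * 'I_n))%type.
pose f (p : P) s := A s (delta_mx 0 p.1.1) (delta_mx 0 p.1.2)
  (delta_mx 0 p.2.1) (delta_mx 0 p.2.2).
have /choice[c hc] : forall p : P, exists c, 0 <= c /\
    \forall s \near t, D s -> `|f p s - f p t| <= c * `|s - t|.
  move=> p; have [c c0 hc] := is_derive_within_lipschitz
    (@ode t ht (delta_mx 0 p.1.1) (delta_mx 0 p.1.2)
      (delta_mx 0 p.2.1) (delta_mx 0 p.2.2)).
  by exists c.
exists (\sum_p c p); first by apply: sumr_ge0 => p _; case: (hc p).
have : \forall s \near t, forall p, D s -> `|f p s - f p t| <= c p * `|s - t|.
  exact: (@filter_forall R P (fun p s => D s -> `|f p s - f p t| <= c p * `|s - t|)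
    (nbhs t) _ (fun p => (hc p).2)).
apply: filterS => s h Ds.
rewrite /form_norm pair_big /= mulr_suml; apply: ler_sum => p _.
by rewrite /form_axpy mulN1r; exact: h.
Qed.

(** The bound is uniform in the frame: it is what allows minimizing over
    frames at a fixed time, without joint continuity in time and frame. *)
Lemma isotropic_sum_lipschitz t : D t -> exists2 c, 0 <= c &
  \forall s \near t, D s -> forall e1 e2 e3 e4 : 'rV[R]_n,
    orthonormal_family [:: e1; e2; e3; e4] ->
    `|isotropic_sum (A s) e1 e2 e3 e4 - isotropic_sum (A t) e1 e2 e3 e4| <= c * `|s - t|.
Proof.
move=> ht; have [c c0 hc] := form_norm_lipschitz ht.
exists (8 * c); first by rewrite mulr_ge0.
apply: filterS hc => s h Ds e1 e2 e3 e4 fr.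
rewrite -mulN1r -isotropic_sum_axpy -mulrA.
apply: (@isotropic_sum_norm _ _ (form_axpy (A s) (-1) (A t))) => // x y z w cx cy cz cw.
apply: le_trans (h Ds); apply: le_form_norm => //.
by apply: act_axpy; exact: act.
Qed.

Lemma form_norm_bounded t0 : D t0 -> exists M, forall s, 0 <= s <= t0 ->
  form_norm (A s) <= M.
Proof.
move=> ht0; have t00 : 0 <= t0 by case: ht0.
have Ds s : 0 <= s <= t0 -> D s.
  move=> /andP[s0 st]; split=> //; apply: le_lt_trans ht0.2; by rewrite lee_fin.
have [|c _ hc] := @EVT_max _ (fun s => form_norm (A s)) 0 t0 t00; last first.
  by exists (form_norm (A c)) => s hs; apply: hc; rewrite in_itv.
apply/subspace_continuousP => t /=; rewrite in_itv /= => tt.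
have [c c0 hc] := form_norm_lipschitz (Ds _ tt).
apply/cvgrPdist_le => e e0; rewrite near_withinE.
have d0 : 0 < e / (c + 1) by rewrite divr_gt0 // ltr_wpDl.
have hd : \forall s \near t, ball t (e / (c + 1)) s by exact: nbhsx_ballx.
apply: filterS (filterI hc hd) => s [h]; rewrite /ball /= => st.
rewrite /= in_itv /= => /Ds ss.
rewrite distrC; apply: (le_trans (form_norm_dist _ _)); apply: (le_trans (h ss)).
apply: (@le_trans _ _ (c * (e / (c + 1)))).
  by rewrite ler_wpM2l // distrC ltW.
rewrite mulrCA ler_piMr //; first exact: ltW.
by rewrite ler_pdivrMr ?mul1r ?lerDl ?ler01 // ltr_wpDl.
Qed.

Lemma exists_before_near (P : R -> Prop) t d : (\forall s \near t, P s) -> 0 < d -> 0 < t ->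
  exists s, [/\ P s, 0 <= s, s < t & t - s <= d].
Proof.
move=> /nbhs_ballP[r /= r0 hr] d0 t0.
pose h := Num.min (r / 2) (Num.min d t).
have h0 : 0 < h by rewrite !lt_min divr_gt0 ?d0.
have hr2 : h <= r / 2 by rewrite ge_min lexx.
have hd : h <= d by rewrite !ge_min lexx orbT.
have ht : h <= t by rewrite !ge_min lexx !orbT.
exists (t - h); split; [|lra|lra|lra].
apply: hr; rewrite /ball /= opprB addrC subrK gtr0_norm //; lra.
Qed.

Hypothesis h0 : nonneg_isotropic_curvature (A 0).

(** Let ts be the infimum of the times at which some frame has nonpositive
    perturbed isotropic curvature. If the minimum over frames at ts were
    positive it would stay so shortly after; hence some frame f attains 0 at
    ts, all frames being nonnegative there, and ts > 0. The reaction term of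
    f for the perturbed tensor is nonnegative, so that of A ts is at least
    -K d with d the size of the perturbation, while the perturbation grows at
    rate 4 K d: f would be negative just before ts. *)
Lemma perturbed_isotropic_pos (t0 M K eps : R) : D t0 ->
  (forall s, 0 <= s <= t0 -> form_norm (A s) <= M) ->
  0 < K -> 8 * curvQ_modulus n M <= K -> 0 < eps -> eps * expR (K * t0) <= 1 ->
  forall t, 0 <= t <= t0 -> forall e1 e2 e3 e4 : 'rV[R]_n,
    orthonormal_family [:: e1; e2; e3; e4] ->
    0 < isotropic_sum (A t) e1 e2 e3 e4 + 4 * (eps * expR (K * t)).
Proof.
move=> ht0 hM K0 KM eps0 eps1.
have t00 : 0 <= t0 by case: ht0.
have Ds s : 0 <= s <= t0 -> D s.
  move=> /andP[s0 st]; split=> //; apply: le_lt_trans ht0.2; by rewrite lee_fin.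
pose G t e1 e2 e3 e4 := isotropic_sum (A t) e1 e2 e3 e4 + 4 * (eps * expR (K * t)).
have expm s s' : s <= s' -> eps * expR (K * s) <= eps * expR (K * s').
  by move=> ss; rewrite ler_pM2l // ler_expR ler_pM2l.
pose S : set R := [set t | 0 <= t <= t0 /\ exists e1 e2 e3 e4 : 'rV[R]_n,
  orthonormal_family [:: e1; e2; e3; e4] /\ G t e1 e2 e3 e4 <= 0].
suff S0 : S = set0.
  move=> t tt e1 e2 e3 e4 fr; rewrite ltNge; apply/negP => neg.
  have : S t by split=> //; exists e1, e2, e3, e4.
  by rewrite S0.
apply: contrapT => /eqP/set0P[r0 Sr0].
have Slb : lbound S 0 by move=> t [/andP[]].
have hlb : has_lbound S by exists 0.
have hinf : has_inf S by split; [exists r0|].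
pose ts := inf S.
have ts0 : 0 <= ts by apply: lb_le_inf; [exists r0|].
have tsr : ts <= r0 by apply: ge_inf.
have tst0 : ts <= t0 by apply: (le_trans tsr); case: Sr0 => /andP[].
have hts : 0 <= ts <= t0 by rewrite ts0.
have [c c0 hc] := isotropic_sum_lipschitz (Ds _ hts).
set d := eps * expR (K * ts).
have d0 : 0 < d by rewrite mulr_gt0 ?expR_gt0.
have d1 : d <= 1 by apply: le_trans eps1; exact: expm.
have [f1 [f2 [f3 [f4 [ff fmin]]]]] : exists f1 f2 f3 f4 : 'rV[R]_n,
  orthonormal_family [:: f1; f2; f3; f4] /\
    forall g1 g2 g3 g4 : 'rV[R]_n, orthonormal_family [:: g1; g2; g3; g4] ->
    isotropic_sum (A ts) f1 f2 f3 f4 <= isotropic_sum (A ts) g1 g2 g3 g4.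
  case: Sr0 => _ [e1 [e2 [e3 [e4 [fr _]]]]].
  by apply: (isotropic_sum_min _ fr); exact: act (Ds _ hts).
have Gf : isotropic_sum (A ts) f1 f2 f3 f4 + 4 * d <= 0.
  rewrite leNgt; apply/negP => m0.
  set m := _ + _ in m0.
  have /nbhs_ballP[r /= rpos hr] := hc.
  have e0 : 0 < Num.min r (m / (c + 1)).
    by rewrite lt_min rpos divr_gt0 // ltr_wpDl.
  have [s Ss slt] := inf_adherent e0 hinf.
  have tss : ts <= s by apply: ge_inf.
  case: Ss => hs [e1 [e2 [e3 [e4 [fr]]]]]; apply/negP; rewrite -ltNge /G.
  have sr : s - ts < r.
    by rewrite ltrBlDl; apply: (lt_le_trans slt); rewrite lerD2l ge_min lexx.
  have sm : s - ts < m / (c + 1).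
    by rewrite ltrBlDl; apply: (lt_le_trans slt); rewrite lerD2l ge_min lexx orbT.
  have := hr s; rewrite /ball /= distrC ger0_norm ?subr_ge0 //.
  move=> /(_ sr (Ds _ hs) _ _ _ _ fr).
  rewrite ler_norml => /andP[h1 _].
  have h2 := fmin _ _ _ _ fr; have h3 := expm _ _ tss.
  have h4 : c * (s - ts) < m.
    rewrite ltr_pdivlMr in sm; last by rewrite ltr_wpDl.
    have : 0 <= s - ts by rewrite subr_ge0.
    have [->|] := eqVneq (s - ts) 0; first by rewrite mulr0.
    move=> sn0 sg0; have : 0 < s - ts by rewrite lt_def sn0.
    by lra.
  rewrite -/d in h3; rewrite /m in h4; lra.
have ts_gt0 : 0 < ts.
  rewrite lt_def ts0 andbT; apply/eqP => tsE; move: Gf; rewrite tsE.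
  apply/negP; rewrite -ltNge.
  have hA0 : algebraic_curvature_tensor (A 0) by apply: act; apply: Ds; rewrite lexx.
  have := h0 ff; rewrite -(isotropic_sumE hA0); lra.
have before s : 0 <= s < ts -> forall e1 e2 e3 e4 : 'rV[R]_n,
    orthonormal_family [:: e1; e2; e3; e4] -> 0 < G s e1 e2 e3 e4.
  move=> /andP[s0 st] e1 e2 e3 e4 fr; rewrite ltNge; apply/negP => neg.
  have : S s.
    by split; [rewrite s0 (le_trans (ltW st))|exists e1, e2, e3, e4].
  by move=> /(ge_inf hlb); rewrite leNgt st.
have Gge e1 e2 e3 e4 (fr : orthonormal_family [:: e1; e2; e3; e4]) :
    0 <= isotropic_sum (A ts) e1 e2 e3 e4 + 4 * d.
  rewrite leNgt; apply/negP => neg.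
  set m := _ + _ in neg.
  have mp : 0 < - m / (c + 1) by rewrite divr_gt0 ?oppr_gt0 // ltr_wpDl.
  have [s [h1 s0 st sm]] := exists_before_near hc mp ts_gt0.
  have hs : 0 <= s <= t0 by rewrite s0 (le_trans (ltW st)).
  have := h1 (Ds _ hs) _ _ _ _ fr.
  rewrite distrC [`|s - ts|]distrC [`|ts - s|]gtr0_norm ?subr_gt0 //.
  rewrite ler_norml => /andP[h2 h3].
  have := before s _ _ _ _ _ fr; rewrite s0 st /G => /(_ isT) h4.
  have h5 := expm _ _ (ltW st); rewrite -/d in h5.
  rewrite ler_pdivlMr in sm; last by rewrite ltr_wpDl.
  have h6 : 0 < ts - s by rewrite subr_gt0.
  by rewrite /m in sm; lra.
pose B := form_axpy (A ts) d (@sphere_curv R n).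
have hB : algebraic_curvature_tensor B.
  by apply: act_axpy; [exact: act (Ds _ hts)|exact: sphere_act].
have BE e1 e2 e3 e4 (fr : orthonormal_family [:: e1; e2; e3; e4]) :
    isotropic_sum B e1 e2 e3 e4 = isotropic_sum (A ts) e1 e2 e3 e4 + 4 * d.
  by rewrite isotropic_sum_axpy (sphere_isotropic fr) (mulrC d).
have NB : nonneg_isotropic_curvature B.
  by move=> e1 e2 e3 e4 fr; rewrite -(isotropic_sumE hB) BE //; exact: Gge.
have Bf0 : isotropic_sum B f1 f2 f3 f4 = 0.
  by apply/eqP; rewrite BE // eq_le Gf Gge.
have QB := curvQ_isotropic_ge0 hB NB ff Bf0.
set q := isotropic_sum (curvQ (A ts)) f1 f2 f3 f4.
have qge : - (K * d) <= q.
  have := @isotropic_sum_norm _ _ (form_axpy (curvQ B) (-1) (curvQ (A ts)))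
    (d * curvQ_modulus n M) f1 f2 f3 f4 _ ff.
  rewrite isotropic_sum_axpy -/q mulN1r ler_norml.
  case/(_ _)/andP => [x y z w cx cy cz cw|_ h].
    rewrite /form_axpy mulN1r; apply: curvQ_perturb => //; last by rewrite ltW.
      exact: act (Ds _ hts).
    exact: hM.
  have : 8 * (d * curvQ_modulus n M) <= K * d.
    by rewrite mulrCA mulrC ler_pM2r.
  lra.
(* Comparing at s just before ts: half of K d absorbs the error of the
   derivative, and ts - s <= 1/(2K) keeps the perturbation above d/2. *)
have eta0 : 0 < K * d / 2 by rewrite divr_gt0 // mulr_gt0.
have near_s :=
  is_derive_within_near (@isotropic_sum_derive ts f1 f2 f3 f4 (Ds _ hts)) eta0.
have Kp : 0 < (2 * K)^-1 by rewrite invr_gt0 mulr_gt0.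
have [s [h1 s0 st sm]] := exists_before_near near_s Kp ts_gt0.
have hs : 0 <= s <= t0 by rewrite s0 (le_trans (ltW st)).
have := h1 (Ds _ hs); rewrite lt_eqF // => /(_ isT).
rewrite -/q [`|s - ts|]distrC [`|ts - s|]gtr0_norm ?subr_gt0 // ler_norml => /andP[_ h2].
have := before s _ _ _ _ _ ff; rewrite s0 st /G => /(_ isT) h3.
have h6 : 0 < ts - s by rewrite subr_gt0.
have Kh : K * (ts - s) <= 1 / 2.
  rewrite -(ler_pM2l K0) in sm; apply: (le_trans sm).
  by rewrite le_eqVlt; apply/orP; left; apply/eqP; field; rewrite gt_eqF.
have h4 : eps * expR (K * s) * (1 + K * (ts - s)) <= d.
  rewrite /d -mulrA ler_pM2l //.
  have -> : expR (K * ts) = expR (K * s) * expR (K * (ts - s)).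
    by rewrite -expRD; congr expR; ring.
  by rewrite ler_pM2l ?expR_gt0 // expR_ge1Dx.
have h5 : d * (1 - K * (ts - s)) <= eps * expR (K * s).
  rewrite /d -mulrA ler_pM2l //.
  have -> : expR (K * s) = expR (K * ts) * expR (- (K * (ts - s))).
    by rewrite -expRD; congr expR; ring.
  by rewrite ler_pM2l ?expR_gt0 // expR_ge1Dx.
set x := eps * expR (K * s) in h3 h4 h5.
have xd : d / 2 <= x by nra.
have h7 : x + K * (ts - s) * (d / 2) <= d.
  have : K * (ts - s) * (d / 2) <= K * (ts - s) * x.
    by rewrite ler_pM2l // mulr_gt0.
  lra.
have h8 : - (K * d) * (ts - s) <= q * (ts - s) by rewrite ler_pM2r.
have Fts : isotropic_sum (A ts) f1 f2 f3 f4 = - (4 * d).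
  by move: Bf0; rewrite BE // => /eqP; rewrite addr_eq0 => /eqP.
rewrite Fts in h2.
have h9 : 0 < K * (ts - s) * d by apply: mulr_gt0 => //; exact: mulr_gt0.
lra.
Qed.

End Evolution.

Theorem proposition11 (R : realType) (n : nat) (hn : (4 <= n)%N)
    (T : \bar R) (A : R -> form4 R n) (hA : curvature_ode_solution T A)
    (h0 : nonneg_isotropic_curvature (A 0)) :
  forall t : R, time_interval T t -> nonneg_isotropic_curvature (A t).
Proof.
move=> t ht e1 e2 e3 e4 fr; rewrite -(isotropic_sumE (hA t ht).1).
have t0 : 0 <= t by case: ht.
have [M hM] := form_norm_bounded hA ht.
pose K := Num.max 1 (8 * curvQ_modulus n M).
have K0 : 0 < K by rewrite lt_max ltr01.
have KM : 8 * curvQ_modulus n M <= K by rewrite le_max lexx orbT.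
rewrite leNgt; apply/negP => neg.
set F := isotropic_sum _ _ _ _ _ in neg.
(* A perturbation of size m <= -F/4 at time t cannot make F positive. *)
pose m := Num.min 1 (- F / 4).
have m0 : 0 < m by rewrite lt_min ltr01 divr_gt0 // oppr_gt0.
have m1 : m <= 1 by rewrite ge_min lexx.
have mF : m <= - F / 4 by rewrite ge_min lexx orbT.
have epsE : m / expR (K * t) * expR (K * t) = m.
  by rewrite divfK // gt_eqF // expR_gt0.
have := @perturbed_isotropic_pos _ _ _ _ hA h0 t M K (m / expR (K * t)) ht hM K0 KM.
rewrite epsE divr_gt0 ?expR_gt0 // => /(_ isT m1 t) h.
have := h _ e1 e2 e3 e4 fr; rewrite t0 lexx epsE -/F => /(_ isT); lra.
Qed.
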